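(* Let $d\ge 2$ be an integer, $V>0$, $\sigma>0$, and let $n_1,\dots,n_d\ge1$ be integers with $n=n_1\cdots n_d$ and $n_j\ge c_sn^{1/d}$ for $j=1,\dots,d$, where $c_s\in(0,1]$. Consider the lattice design $\mathbb L_{n_1,\dots,n_d}$. Then there exists a constant $C_d>0$ depending only on $d$ and $c_s$ such that $$\mathfrak M_{\mathrm{HK},\sigma,V,d}(n)\ge C_d\left(\frac{\sigma^2V}{n}\right)^{2/3}\left(\log\left(\frac{V\sqrt n}{\sigma}\right)\right)^{\frac{2(d-1)}{3}}$$ provided $n$ is larger than a positive constant depending only on $d$, $\sigma^2/V^2$ and $c_s$. In the case $d=2$ this bound can be tightened to $$\mathfrak M_{\mathrm{HK},\sigma,V,2}(n)\ge C\left(\frac{\sigma^2V}{n}\right)^{2/3}\log\left(\frac{V\sqrt n}{\sigma}\right)$$ for a positive constant $C$ depending only on $c_s$, again provided $n$ is larger than a positive constant depending only on $\sigma^2/V^2$ and $c_s$.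
   Context: Notation: $\mathbf 0=(0,\dots,0)$; $\mathbf a\preceq\mathbf b$ means $a_j\le b_j$ for all $j$; for $\mathbf a\preceq\mathbf b$, $[\mathbf a,\mathbf b]=\prod_j[a_j,b_j]$. Quasi-volume: for $f:[0,1]^d\to\mathbb R$ and distinct $\mathbf a\preceq\mathbf b$ in $[0,1]^d$, $$\Delta(f;[\mathbf a,\mathbf b])=\sum_{j_1=0}^{J_1}\cdots\sum_{j_d=0}^{J_d}(-1)^{j_1+\dots+j_d}f(b_1+j_1(a_1-b_1),\dots,b_d+j_d(a_d-b_d)),$$ where $J_i=1$ if $a_i\ne b_i$ and $J_i=0$ otherwise. Vitali variation: given univariate partitions $0=x^{(s)}_0<\dots<x^{(s)}_{k_s}=1$, $s=1,\dots,d$, the split they generate is the collection $\mathcal P$ of all rectangles $\prod_{s=1}^d[x^{(s)}_{l_s},x^{(s)}_{l_s+1}]$, $0\le l_s\le k_s-1$. Set $V^{(d)}(f;[0,1]^d)=\sup_{\mathcal P}\sum_{A\in\mathcal P}|\Delta(f;A)|$, supremum over all such splits. HK$\mathbf 0$ variation: for nonempty $S\subseteq\{1,\dots,d\}$ let $f_S:[0,1]^{|S|}\to\mathbb R$ be the restriction of $f$ to $\{\mathbf u\in[0,1]^d:u_j=0\ \forall j\notin S\}$, viewed as a function of the coordinates in $S$. Then $V_{\mathrm{HK}\mathbf 0}(f)=\sum_{\varnothing\ne S\subseteq\{1,\dots,d\}}V^{(|S|)}(f_S;[0,1]^{|S|})$. Lattice design: the design points $\mathbf x_1,\dots,\mathbf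 x_n$ are an enumeration of $\mathbb L_{n_1,\dots,n_d}=\{(i_1/n_1,\dots,i_d/n_d):0\le i_j\le n_j-1,\ j=1,\dots,d\}$. Model: under $f^*$ one observes $y_i=f^*(\mathbf x_i)+\xi_i$, $i=1,\dots,n$, with $\xi_i$ i.i.d. $N(0,\sigma^2)$; $\mathbb E_{f^*}$ is expectation under this model. Loss: $\mathcal L(\hat f,f^* )=\frac1n\sum_{i=1}^n(\hat f(\mathbf x_i)-f^*(\mathbf x_i))^2$. Minimax risk: $\mathfrak M_{\mathrm{HK},\sigma,V,d}(n)=\inf_{\hat f_n}\sup_{f^*:[0,1]^d\to\mathbb R,\;V_{\mathrm{HK}\mathbf 0}(f^* )\le V}\mathbb E_{f^*}\mathcal L(\hat f_n,f^* )$, the infimum being over all estimators $\hat f_n$ based on $y_1,\dots,y_n$. *)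

(* Defs.v *)
From HB Require Import structures.
From mathcomp Require Import all_boot all_order all_algebra.
From mathcomp Require Import all_classical all_reals all_analysis.
Import Order.TTheory GRing.Theory Num.Theory.
Import numFieldNormedType.Exports.

Set Implicit Arguments.
Unset Strict Implicit.
Unset Printing Implicit Defensive.

Local Open Scope classical_set_scope.
Local Open Scope ring_scope.

(* Functions on the cube [0,1]^I are represented by total functions on
   {ffun I -> R}; every notion below only evaluates them at points of the
   cube. The finite type of coordinates I is 'I_d or a subset of 'I_d. *)

Definition unit_cube (R : realType) (I : finType) : set {ffun I -> R} :=
  [set u | forall i, 0 <= u i <= 1].

(* The index j i ranges over {0, 1} if a i != b i, over {0} otherwise. *)
Definition quasi_volume (R : realType) (I : finType)
    (f : {ffun I -> R} -> R) (a b : {ffun I -> R}) : R :=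
  \sum_(j : {ffun I -> bool} | [forall i, j i ==> (a i != b i)])
     (-1) ^+ (\sum_i j i) * f [ffun i => b i + (j i)%:R * (a i - b i)].

(* A univariate partition 0 = x_0 < ... < x_k = 1 is given by the sequence
   p = [:: x_1; ...; x_k], so that its l-th interval (0 <= l < k) has endpoints
   nth 0 (0 :: p) l = x_l and nth 0 p l = x_(l+1). *)
Definition split_sum (R : realType) (I : finType)
    (f : {ffun I -> R} -> R) (p : I -> seq R) : R :=
  \sum_(l : {dffun forall s : I, 'I_(size (p s))})
     `| quasi_volume f [ffun s => nth 0 (0 :: p s) (l s)]
                       [ffun s => nth 0 (p s) (l s)] |.

Definition vitali_variation (R : realType) (I : finType)
    (f : {ffun I -> R} -> R) : \bar R :=
  ereal_sup [set (split_sum f p)%:E |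
    p in [set p : I -> seq R | forall s, itv_partition 0 1 (p s)]].

Definition face_restriction (R : realType) (d : nat)
    (f : {ffun 'I_d -> R} -> R) (S : {set 'I_d})
    (u : {ffun {j : 'I_d | j \in S} -> R}) : R :=
  f [ffun j => oapp u 0 (insub j)].

Definition HK0_variation (R : realType) (d : nat)
    (f : {ffun 'I_d -> R} -> R) : \bar R :=
  (\sum_(S : {set 'I_d} | S != finset.set0)
     vitali_variation (@face_restriction R d f S))%E.

Definition lattice (R : realType) (d : nat) (m : 'I_d -> nat) :
    set {ffun 'I_d -> R} :=
  [set u | exists2 i : 'I_d -> nat, (forall j, (i j < m j)%N) &
           u = [ffun j => (i j)%:R / (m j)%:R]].

Definition lattice_design (R : realType) (d : nat) (m : 'I_d -> nat) (n : nat)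
    (x : 'I_n -> {ffun 'I_d -> R}) : Prop :=
  injective x /\ range x = @lattice R d m.

Definition mutually_independent (R : realType) (disp : measure_display)
    (T : measurableType disp) (P : probability T R) (n : nat)
    (xi : 'I_n -> {RV P >-> R}) : Prop :=
  forall (J : {set 'I_n}) (A : 'I_n -> set R), (forall i, measurable (A i)) ->
    P (\bigcap_(i in [set` J]) (xi i @^-1` A i)) =
    (\prod_(i in J) P (xi i @^-1` A i))%E.

(* The second parameter of normal_prob is the standard deviation. *)
Definition iid_normal (R : realType) (disp : measure_display)
    (T : measurableType disp) (P : probability T R) (n : nat)
    (sigma : R) (xi : 'I_n -> {RV P >-> R}) : Prop :=
  (forall i (A : set R), measurable A ->
     distribution P (xi i) A = normal_prob 0 sigma A) /\
  mutually_independent xi.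

Definition estimator (R : realType) (d n : nat) :
    set (n.-tuple R -> {ffun 'I_d -> R} -> R) :=
  [set fhat | forall u, unit_cube u ->
     measurable_fun [set: n.-tuple R] (fun y => fhat y u)].

Definition loss (R : realType) (d n : nat) (x : 'I_n -> {ffun 'I_d -> R})
    (g f : {ffun 'I_d -> R} -> R) : R :=
  n%:R^-1 * \sum_(i < n) (g (x i) - f (x i)) ^+ 2.

Definition observations (R : realType) (d n : nat)
    (x : 'I_n -> {ffun 'I_d -> R}) (disp : measure_display)
    (T : measurableType disp) (P : probability T R)
    (xi : 'I_n -> {RV P >-> R}) (f : {ffun 'I_d -> R} -> R) (w : T) :
    n.-tuple R :=
  [tuple f (x i) + xi i w | i < n].

Definition minimax_risk (R : realType) (d n : nat)
    (x : 'I_n -> {ffun 'I_d -> R}) (disp : measure_display)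
    (T : measurableType disp) (P : probability T R)
    (xi : 'I_n -> {RV P >-> R}) (V : R) : \bar R :=
  ereal_inf [set
    ereal_sup [set 'E_P[fun w => loss x (fhat (observations x xi f w)) f]%E |
               f in [set f | (HK0_variation f <= V%:E)%E]] |
    fhat in @estimator R d n].

(* Main.v *)
(** The risk is bounded below by Assouad's lemma over functions that are
    distribution functions of signed measures [mu e], indexed by bit vectors [e],
    on a sublattice with [4 ^ L] points per axis. A bit belongs to a cell of one
    of many 4-adic grids, which have different shapes but the same cell volume.
    Flipping it changes [mu e] on that cell by a tensor product of waves with
    signs [+, -, -, +] on the quarters of an interval. The primitive of such a
    wave is a tent followed by the opposite tent, so it is orthogonal to functions
    that are constant on its interval, and the bits are read off by orthogonal
    Haar functions with signs [+, +, -, -].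

    For general [d], [mu e] is a signed sum of the waves; these are orthogonal, so
    the total mass, bounded through the L2 norm, is only the square root of the
    number of grids times that of one grid. For [d = 2], [mu e] is a Riesz product
    instead: it is nonnegative with a known total mass, which saves this square
    root. Its factors from grids that are finer in the first coordinate depend, on
    a given cell, on the first coordinate only, and the others on the second only;
    so flipping a bit still produces a tensor product, of waves weighted by
    one-dimensional Riesz products whose zeroth and first moments are trivial. *)
Require Import Defs.
From HB Require Import structures.
From mathcomp Require Import all_boot all_order all_algebra.
From mathcomp Require Import all_classical all_reals all_analysis.
From mathcomp Require Import measurable_realfun lra ring zify.
Import Order.TTheory GRing.Theory Num.Theory.
Import numFieldNormedType.Exports.

Local Open Scope classical_set_scope.
Local Open Scope ring_scope.

(** * Gaussian shifts *)

Section Density.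
Context {d : measure_display} {T : measurableType d} {R : realType}.
Variables mu nu : {measure set T -> \bar R}.
Variable g : T -> R.
Hypotheses (mg : measurable_fun [set: T] g) (g0 : forall x, 0 <= g x).
Hypothesis nuE : forall A, measurable A ->
  nu A = (\int[mu]_(x in A) (g x)%:E)%E.

Import HBNNSimple.

Lemma integral_density_nnsfun (h : {nnsfun T >-> R}) :
  (\int[nu]_x (h x)%:E = \int[mu]_x ((h x)%:E * (g x)%:E))%E.
Proof.
have mgE : measurable_fun [set: T] (fun x => (g x)%:E : \bar R) by exact/measurable_EFinP.
have indE r : (\int[mu]_x ((\1_(h @^-1` [set r]) x)%:E * (g x)%:E) =
    nu (h @^-1` [set r]))%E.
  rewrite nuE; last exact: measurable_funPTI.
  rewrite [RHS]integral_mkcond; apply: eq_integral => x _.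
  by rewrite patchE indicE; case: ifPn => _; rewrite ?mul1e ?mul0e.
under eq_integral do rewrite fimfunE -fsumEFin//.
rewrite ge0_integral_fsum//; last 2 first.
  - by move=> r; exact/measurable_EFinP/measurableT_comp.
  - by move=> n x _; rewrite EFinM nnfun_muleindic_ge0.
transitivity (\int[mu]_x (\sum_(y \in range h)
    (y * \1_(h @^-1` [set y]) x)%:E * (g x)%:E))%E; last first.
  apply: eq_integral => x _.
  rewrite -ge0_mule_fsuml => [|y]; last exact: nnfun_muleindic_ge0.
  by rewrite fsumEFin // -(fimfunE _ x).
rewrite ge0_integral_fsum//; last 2 first.
  - by move=> y; apply: emeasurable_funM => //; exact/measurable_EFinP/measurableT_comp.
  - by move=> m y _; rewrite mule_ge0 ?lee_fin// -lee_fin nnfun_muleindic_ge0.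
apply: eq_fsbigr => r /[!inE] -[t _ <-].
under [RHS]eq_integral do rewrite EFinM -muleA.
under [LHS]eq_integral do rewrite EFinM.
have ht0 : (0 <= (h t)%:E)%E by rewrite lee_fin.
rewrite !ge0_integralZl//; last first.
- exact/measurable_EFinP.
- by move=> x _; rewrite mule_ge0// lee_fin.
- by apply: emeasurable_funM => //; exact/measurable_EFinP.
by rewrite integral_indic ?setIT ?indE.
Qed.

(** Monotone convergence, on both sides, along simple functions increasing to [f]. *)
Lemma integral_density (f : T -> \bar R) : measurable_fun [set: T] f ->
  (forall x, 0 <= f x)%E ->
  (\int[nu]_x f x = \int[mu]_x (f x * (g x)%:E))%E.
Proof.
move=> mf f0; pose h := nnsfun_approx measurableT mf.
have mgE : measurable_fun [set: T] (fun x => (g x)%:E : \bar R) by exact/measurable_EFinP.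
have fE x : f x = lim ((EFin \o h n) x @[n --> \oo]).
  by apply/esym/cvg_lim => //; exact: cvg_nnsfun_approx.
have -> : (\int[nu]_x f x = lim (\int[nu]_x (EFin \o h n) x @[n --> \oo]))%E.
  under eq_integral do rewrite fE.
  apply: monotone_convergence => //.
  - by move=> n; exact/measurable_EFinP.
  - by move=> n x _ /=; rewrite lee_fin.
  - by move=> x _ a b ab; rewrite lee_fin; exact/lefP/nd_nnsfun_approx.
have -> : (\int[mu]_x (f x * (g x)%:E) =
    lim (\int[mu]_x ((EFin \o h n) x * (g x)%:E) @[n --> \oo]))%E.
  have fgE x : (f x * (g x)%:E =
      lim ((EFin \o h n) x * (g x)%:E @[n --> \oo]))%E.
    by apply/esym/cvg_lim => //; apply: cvgeZr => //; exact: cvg_nnsfun_approx.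
  under eq_integral do rewrite fgE.
  apply: monotone_convergence => //.
  - by move=> n; apply: emeasurable_funM => //; exact/measurable_EFinP.
  - by move=> n x _ /=; rewrite mule_ge0 ?lee_fin.
  - move=> x _ a b ab /=; rewrite lee_wpmul2r ?lee_fin//.
    exact/lefP/nd_nnsfun_approx.
by congr (limn _); apply/funext => n; exact: integral_density_nnsfun.
Qed.

End Density.

(** The pushforward, handed over as a bare measure known only through its values and its change of
    variables; [density_measure] does the same for densities. *)
Lemma image_measure {d d' : measure_display} {T : measurableType d}
    {T' : measurableType d'} {R : realType} (mu : {measure set T -> \bar R})
    (f : T -> T') : measurable_fun [set: T] f ->
  exists2 nu : {measure set T' -> \bar R}, (forall A, nu A = mu (f @^-1` A)) &
  forall g : T' -> \bar R, measurable_fun [set: T'] g ->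
    (forall x, 0 <= g x)%E -> (\int[nu]_y g y = \int[mu]_x g (f x))%E.
Proof.
move=> mf.
exists (measure_function_pushforward__canonical__measure_function_Measure mu mf) => //.
move=> g mg g0; rewrite -[in RHS](preimage_setT f).
by rewrite -ge0_integral_pushforward.
Qed.

Lemma density_measure {d : measure_display} {T : measurableType d} {R : realType}
    (mu : {measure set T -> \bar R}) (g : T -> R) :
    measurable_fun [set: T] g -> (forall x, 0 <= g x) ->
  exists2 nu : {measure set T -> \bar R},
    (forall A, nu A = (\int[mu]_(x in A) (g x)%:E)%E) &
  forall f : T -> \bar R, measurable_fun [set: T] f ->
    (forall x, 0 <= f x)%E ->
    (\int[nu]_x f x = \int[mu]_x (f x * (g x)%:E))%E.
Proof.
move=> mg g0; pose nu0 A := (\int[mu]_(x in A) (g x)%:E)%E.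
have nu00 : nu0 set0 = 0%E by rewrite /nu0 integral_set0.
have nu0_ge0 A : (0 <= nu0 A)%E.
  by apply: integral_ge0 => x _; rewrite lee_fin.
have nu0_additive : semi_sigma_additive nu0.
  apply: semi_sigma_additive_nng_induced => [|x]; last by rewrite lee_fin.
  exact/measurable_EFinP.
pose nu : {measure set T -> \bar R} := HB.pack nu0
  (isMeasure.Build _ _ _ nu0 nu00 nu0_ge0 nu0_additive).
exists nu => // f mf f0.
exact: (@integral_density _ _ _ mu nu g mg g0).
Qed.

Section NormalShift.
Context {R : realType}.
Local Notation leb := (@lebesgue_measure R).

Lemma lebesgue_measure_shift (c : R) (A : set (measurableTypeR R)) :
  measurable A -> leb ((fun x => x + c) @^-1` A) = leb A.
Proof.
move=> mA.
have mf : measurable_fun [set: measurableTypeR R]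
  (fun x : measurableTypeR R => x + c : measurableTypeR R).
  by apply: measurable_funD => //; exact: measurable_cst.
suff : pushforward leb (fun x : measurableTypeR R => x + c : measurableTypeR R) A
  = leb A by [].
apply/esym/lebesgue_measure_unique => //= _ [[a b]] _ <-.
rewrite /pushforward /=.
rewrite (_ : _ @^-1` _ = `]a - c, b - c]%classic); last first.
  by apply/seteqP; split=> x /=; rewrite !in_itv/= ltrBlDr lerBrDr.
by rewrite !lebesgue_measure_itv/= !lte_fin ltrD2r -!EFinB opprB addrA subrK.
Qed.

(* Density of N(c, s^2) with respect to N(0, s^2). *)
Definition likelihood (s c x : R) : R :=
  expR (c * x / s ^+ 2 - c ^+ 2 / (2 * s ^+ 2)).

Lemma measurable_likelihood (s c : R) :
  measurable_fun [set: R] (likelihood s c).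
Proof.
apply: measurableT_comp => //; apply: measurable_funB => //.
by apply: measurable_funM => //; apply: measurable_funM.
Qed.

(** After a translation of Lebesgue measure this is the quotient of two normal densities; expanding
    the square gives the exponent of [likelihood]. *)
Lemma normal_prob_shift (s c : R) (A : set R) : s != 0 -> measurable A ->
  normal_prob 0 s ((fun x => x + c) @^-1` A) =
  (\int[normal_prob 0 s]_(x in A) (likelihood s c x)%:E)%E.
Proof.
move=> s0 mA.
rewrite [RHS]integral_mkcond.
rewrite (@integral_density _ _ _ leb _ (normal_pdf 0 s)); last 5 first.
- exact: measurable_normal_pdf.
- exact: normal_pdf_ge0.
- by [].
- apply/(measurable_restrictT _ _).1 => //.
  by apply/measurable_EFinP; apply: measurable_funTS; exact: measurable_likelihood.
- by apply: erestrict_ge0 => x _; rewrite lee_fin expR_ge0.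
have mf : measurable_fun [set: measurableTypeR R]
  (fun x : measurableTypeR R => x + c : measurableTypeR R).
  by apply: measurable_funD => //; exact: measurable_cst.
transitivity (\int[pushforward leb
    (fun x : measurableTypeR R => (x + c)%R : measurableTypeR R)]_(y in A)
   (normal_pdf 0 s (y - c)%R)%:E)%E.
  rewrite ge0_integral_pushforward//.
  - by apply: eq_integral => x _ /=; rewrite addrK.
  - apply/measurable_EFinP/measurable_funTS.
    apply: (measurableT_comp (measurable_normal_pdf 0 s)).
    exact: measurable_funB.
  - by move=> y _; rewrite lee_fin normal_pdf_ge0.
rewrite [LHS](eq_measure_integral leb); last first.
  by move=> B mB _; exact: lebesgue_measure_shift.
rewrite integral_mkcond; apply: eq_integral => x _.
rewrite !patchE; case: ifPn => _; last by rewrite mul0e.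
rewrite -EFinM /normal_pdf (negPf s0) /normal_fun mulrCA /likelihood -expRD.
congr (_ * expR _)%:E; rewrite !subr0 -[_ *+ 2]mulr_natl.
by field.
Qed.

End NormalShift.

Section GaussianShift.
Context {R : realType} {disp : measure_display} {T : measurableType disp}.
Context {P : probability T R} {n : nat} {xi : 'I_n -> {RV P >-> R}} {s : R}.
Hypotheses (s0 : s != 0) (xi_iid : iid_normal s xi).

Let noise (w : T) : n.-tuple R := [tuple xi i w | i < n].

Lemma measurable_noise : measurable_fun [set: T] noise.
Proof.
apply/measurable_fun_tnthP => i.
rewrite (_ : _ \o _ = xi i); first exact: measurable_funPT.
by apply/funext => w /=; rewrite tnth_mktuple.
Qed.

Definition tshift (h : 'I_n -> R) (y : n.-tuple R) : n.-tuple R :=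
  [tuple tnth y i + h i | i < n].

Lemma measurable_tshift (h : 'I_n -> R) : measurable_fun [set: n.-tuple R] (tshift h).
Proof.
apply/measurable_fun_tnthP => i.
rewrite (_ : _ \o _ = fun y => tnth y i + h i).
  by apply: measurable_funD => //; exact: measurable_tnth.
by apply/funext => w /=; rewrite tnth_mktuple.
Qed.

Definition box (B : 'I_n -> set R) : set (n.-tuple R) :=
  [set y | forall i, B i (tnth y i)].

Lemma measurable_box (B : 'I_n -> set R) : (forall i, measurable (B i)) ->
  measurable (box B).
Proof.
move=> mB.
rewrite (_ : box B = \bigcap_(i in [set: 'I_n]) ((tnth (T := R))^~ i @^-1` B i)).
  apply: fin_bigcap_measurable => // i _.
  by rewrite -[_ @^-1` _]setTI; exact: measurable_tnth.
by apply/seteqP; split => y /= h i => [_|]; exact: h.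
Qed.

(** A coordinate cylinder is a box whose other sides are the whole line, so boxes generate. *)
Lemma tuple_measurable_box (A : set (n.-tuple R)) : measurable A ->
  <<s [set box B | B in [set B : 'I_n -> set R | forall i, measurable (B i)]] >> A.
Proof.
apply: smallest_sub; first exact: smallest_sigma_algebra.
rewrite -bigcup_seq => _ [i _ [A' mA' <-]]; apply: sub_sigma_algebra.
exists (fun j => if j == i then A' else [set: R]).
  by move=> j; case: ifP.
apply/seteqP; split => y /=.
  by move=> /(_ i); rewrite eqxx.
by move=> [_ Ay] j; case: eqP => [->|].
Qed.

Lemma setI_closed_box :
  setI_closed [set box B | B in [set B : 'I_n -> set R | forall i, measurable (B i)]].
Proof.
move=> _ _ [B1 mB1 <-] [B2 mB2 <-]; exists (fun i => B1 i `&` B2 i).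
  by move=> i; apply: measurableI.
apply/seteqP; split => y /=.
  by move=> h; split => i; have [] := h i.
by move=> [h1 h2] i; split; [exact: h1|exact: h2].
Qed.

Lemma noise_marginal (i : 'I_n) (A : set R) : measurable A ->
  P (xi i @^-1` A) = normal_prob 0 s A.
Proof. by have [h _] := xi_iid; move=> mA; rewrite -(h i). Qed.

Lemma noise_box (B : 'I_n -> set R) : (forall i, measurable (B i)) ->
  P (noise @^-1` box B) = (\prod_(i < n) normal_prob 0 s (B i))%E.
Proof.
have [_ h] := xi_iid; move=> mB; have := h (finset.setTfor 'I_n) B mB.
rewrite (_ : \bigcap_(i in _) _ = noise @^-1` box B); last first.
  apply/seteqP; split => w /= {}h i.
    by rewrite tnth_mktuple; apply: h; rewrite /= inE.
  by have := h i; rewrite tnth_mktuple.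
move=> ->; rewrite (eq_bigl xpredT); last by move=> i; rewrite inE.
by apply: eq_bigr => i _; rewrite noise_marginal.
Qed.

Lemma noise_box_split (i : 'I_n) (B : 'I_n -> set R) (A : set R) :
  (forall j, measurable (B j)) -> measurable A ->
  P (xi i @^-1` A `&` \bigcap_(j in [set` (finset.setC (finset.set1 i))]) (xi j @^-1` B j)) =
  (normal_prob 0 s A * \prod_(j < n | j != i) normal_prob 0 s (B j))%E.
Proof.
move=> mB mA; pose B' j := if j == i then A else B j.
transitivity (P (noise @^-1` box B')).
  congr (P _); apply/seteqP; split => w /=.
    move=> [Aw Bw] j; rewrite /B' tnth_mktuple; case: eqP => [->//|/eqP ji].
    by apply: Bw; rewrite /= !inE.
  move=> h; split; first by have := h i; rewrite /B' tnth_mktuple eqxx.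
  move=> j /=; rewrite !inE => ji.
  by have := h j; rewrite /B' tnth_mktuple (negPf ji).
rewrite noise_box => [|j]; last by rewrite /B'; case: ifP.
rewrite (bigD1 i)//= {1}/B' eqxx; congr (_ * _)%E.
by apply: eq_bigr => j ji; rewrite /B' (negPf ji).
Qed.

Let single (i : 'I_n) (c : R) (j : 'I_n) : R := if j == i then c else 0.

(** By independence the event [E] on the other coordinates contributes only the factor [cE], which
    reduces the claim to [normal_prob_shift]. *)
Lemma noise_shift1_box (i : 'I_n) (c : R) (B : 'I_n -> set R) :
  (forall j, measurable (B j)) ->
  P (noise @^-1` (tshift (single i c) @^-1` box B)) =
  (\int[P]_(w in noise @^-1` box B) (likelihood s c (xi i w))%:E)%E.
Proof.
move=> mB.
have mshift A : measurable A -> measurable ((fun x : R => x + c) @^-1` A).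
  by move=> mA; rewrite -[_ @^-1` _]setTI; apply: measurable_funD.
set E := \bigcap_(j in [set` finset.setC (finset.set1 i)]) (xi j @^-1` B j).
have mE : measurable E.
  apply: fin_bigcap_measurable => // j _.
  by rewrite -[_ @^-1` _]setTI; exact: measurable_funPT.
have -> : noise @^-1` (tshift (single i c) @^-1` box B) =
    xi i @^-1` ((fun x => x + c) @^-1` B i) `&` E.
  apply/seteqP; split => w /=.
    move=> h; split; first by have := h i; rewrite !tnth_mktuple /single eqxx.
    move=> j /=; rewrite !inE => ji.
    by have := h j; rewrite !tnth_mktuple /single (negPf ji) addr0.
  move=> [Bi BE] j; rewrite !tnth_mktuple /single.
  case: eqP => [->//|/eqP ji]; rewrite addr0.
  by apply: BE; rewrite /= !inE.
have -> : noise @^-1` box B = xi i @^-1` B i `&` E.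
  apply/seteqP; split => w /=.
    move=> h; split; first by have := h i; rewrite !tnth_mktuple.
    by move=> j _ /=; have := h j; rewrite !tnth_mktuple.
  move=> [Bi BE] j; rewrite !tnth_mktuple.
  by have [->//|ji] := eqVneq j i; apply: BE; rewrite /= !inE.
rewrite noise_box_split//; last exact: mshift.
rewrite normal_prob_shift//.
set cE := (\prod_(j < n | j != i) _)%E.
have cE0 : (0 <= cE)%E by apply: prode_ge0 => j _; exact: measure_ge0.
have cE_fin : cE \is a fin_num.
  by apply: prode_fin_num => j _; exact: (fin_num_measure (normal_prob 0 s)  _ (mB j)).
have mlik := measurable_likelihood s c.
have mlikE : measurable_fun [set: R] (fun x => (likelihood s c x)%:E : \bar R).
  exact/measurable_EFinP.
have lik0 x : (0 <= (likelihood s c x)%:E :> \bar R)%E by rewrite lee_fin expR_ge0.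
have mf : measurable_fun [set: R] ((fun x => (likelihood s c x)%:E : \bar R) \_ (B i)).
  apply/(measurable_restrictT _ _).1 => //; exact: measurable_funTS.
have f0 x : (0 <= ((fun x => (likelihood s c x)%:E : \bar R) \_ (B i)) x)%E.
  by apply: erestrict_ge0.
have mxi : measurable_fun [set: T] (xi i) by exact: measurable_funPT.
(* [nu] is the law of [xi i] under [P] restricted to [E]; independence identifies it with [nu'], the
   normal law times [cE]. *)
have [muE muEE intE] := @density_measure _ _ _ P (\1_E : T -> R)
  (measurable_indic mE) (fun x => ler0n _ _).
have [nu nuE intnu] := @image_measure _ _ _ (measurableTypeR R) _ muE (xi i) mxi.
have [nu' nu'E intnu'] := @density_measure _ _ _ (normal_prob 0 s) (fun=> fine cE)
  (measurable_cst (fine cE)) (fun x => fine_ge0 cE0).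
transitivity (\int[nu]_(x in B i) (likelihood s c x)%:E)%E.
  transitivity (\int[nu']_(x in B i) (likelihood s c x)%:E)%E; last first.
    apply: (@eq_measure_integral _ _ _ _ nu nu') => A mA _.
    rewrite nuE nu'E muEE integral_indic//; last first.
      by rewrite -[_ @^-1` _]setTI; exact: mxi.
    rewrite (integral_cst (normal_prob 0 s) mA (fine cE)%:E) fineK// muleC.
    rewrite setIC; apply: esym; exact: (noise_box_split i B A mB mA).
  rewrite [RHS]integral_mkcond intnu'// ge0_integralZr//; last by rewrite lee_fin fine_ge0.
  by rewrite fineK// -integral_mkcond.
rewrite integral_mkcond intnu// intE//; last exact: measurableT_comp.
rewrite [RHS]integral_mkcond; apply: eq_integral => w _.
rewrite !patchE indicE in_setI.
have -> : (w \in xi i @^-1` B i) = (xi i w \in B i).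
  by apply/idP/idP; rewrite !inE.
by case: (_ \in _); case: (_ \in _); rewrite ?mule1 ?mule0 ?mul0e.
Qed.

(** Both sides integrate [G], once against the law of the shifted noise and once against a
    reweighted law of the noise; these laws agree on boxes, a generating pi-system. *)
Lemma noise_shift1 (i : 'I_n) (c : R) (G : n.-tuple R -> \bar R) :
  measurable_fun [set: n.-tuple R] G -> (forall y, 0 <= G y)%E ->
  (\int[P]_w G (tshift (single i c) (noise w)) =
   \int[P]_w (G (noise w) * (likelihood s c (tnth (noise w) i))%:E))%E.
Proof.
move=> mG G0.
have mlik : measurable_fun [set: n.-tuple R] (fun y => likelihood s c (tnth y i)).
  apply: (measurableT_comp (measurable_likelihood s c)).
  exact: measurable_tnth.
have msh := measurableT_comp (measurable_tshift (single i c)) measurable_noise.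
have [nu1 nu1E int1] := @image_measure _ _ _ _ _ P _ msh.
have [mu muE intmu] := @image_measure _ _ _ _ _ P _ measurable_noise.
have [nu2 nu2E int2] := @density_measure _ _ _ mu _ mlik (fun x => expR_ge0 _).
rewrite -int1// -[RHS](intmu (fun y => G y * (likelihood s c (tnth y i))%:E)%E); last 2 first.
- by apply: emeasurable_funM => //; exact/measurable_EFinP.
- by move=> y; rewrite mule_ge0 ?lee_fin ?expR_ge0.
rewrite -int2//; apply: eq_measure_integral => A mA _.
apply: (@g_sigma_algebra_measure_unique _ _ _
  [set box B | B in [set B : 'I_n -> set R | forall i, measurable (B i)]] _
  (fun=> setT)) => //.
- by move=> _ [B mB <-]; exact: measurable_box.
- by move=> _; exists (fun=> setT) => //; apply/seteqP; split.
- by rewrite bigcup_const//; exists 0%N.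
- exact: setI_closed_box.
- move=> _ [B mB <-]; rewrite nu1E.
  transitivity (P (noise @^-1` (tshift (single i c) @^-1` box B))); first by [].
  rewrite noise_shift1_box//.
  have mb := measurable_box B mB.
  rewrite nu2E integral_mkcond intmu; last 2 first.
  + apply/(measurable_restrictT _ _).1 => //.
    by apply: measurable_funTS; exact/measurable_EFinP.
  + by apply: erestrict_ge0 => y _; rewrite lee_fin expR_ge0.
  rewrite [LHS]integral_mkcond; apply: eq_integral => w _.
  rewrite !patchE tnth_mktuple.
  by congr (if _ then _ else _); apply/idP/idP; rewrite !inE.
- by move=> _; rewrite nu1E -[ltLHS]/(P [set: T]) probability_setT ltry.
- exact: tuple_measurable_box.
Qed.

(** One coordinate at a time: the likelihood of coordinate [i] passes unchanged through the shift of
    the others, since [i] is not in [r]. *)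
Lemma noise_shift_seq (h : 'I_n -> R) (r : seq 'I_n) (G : n.-tuple R -> \bar R) :
  uniq r -> measurable_fun [set: n.-tuple R] G -> (forall y, 0 <= G y)%E ->
  (\int[P]_w G (tshift (fun j => if j \in r then h j else 0%R) (noise w)) =
   \int[P]_w (G (noise w) *
     (\prod_(i <- r) likelihood s (h i) (tnth (noise w) i))%R%:E))%E.
Proof.
elim: r G => [|i r IHr] G /=; [move=> _ _ _|move=> /andP[ir ur] mG G0].
  apply: eq_integral => w _; rewrite big_nil mule1; congr G.
  by apply: eq_from_tnth => j; rewrite tnth_mktuple addr0.
set hr := fun j => if j \in r then h j else 0.
have mlik : measurable_fun [set: n.-tuple R]
    (fun y => (likelihood s (h i) (tnth y i))%:E : \bar R).
  apply/measurable_EFinP/(measurableT_comp (measurable_likelihood s (h i))).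
  exact: measurable_tnth.
transitivity (\int[P]_w G (tshift hr (tshift (single i (h i)) (noise w))))%E.
  apply: eq_integral => w _; congr G; apply: eq_from_tnth => j.
  rewrite !tnth_mktuple inE /hr /single.
  by case: eqP => [->|_]; rewrite ?(negPf ir) ?addr0.
rewrite (noise_shift1 i (h i) (G \o tshift hr)) => [|//|]; last 2 first.
- exact: (measurableT_comp mG (measurable_tshift hr)).
- by move=> y; exact: G0.
transitivity (\int[P]_w ((fun y => G y * (likelihood s (h i) (tnth y i))%:E)
     (tshift hr (noise w))))%E.
  apply: eq_integral => w _ /=; congr (_ * (likelihood _ _ _)%:E)%E.
  by rewrite [RHS]tnth_mktuple /hr (negPf ir) addr0.
rewrite (IHr (fun y => G y * (likelihood s (h i) (tnth y i))%:E)%E)//; last 2 first.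
- exact: emeasurable_funM.
- by move=> y; rewrite mule_ge0 ?lee_fin ?expR_ge0.
by apply: eq_integral => w _; rewrite big_cons EFinM muleA.
Qed.

Definition tuple_likelihood (h : 'I_n -> R) (y : n.-tuple R) : R :=
  \prod_(i < n) likelihood s (h i) (tnth y i).

Lemma tuple_likelihood_ge0 (h : 'I_n -> R) (y : n.-tuple R) :
  0 <= tuple_likelihood h y.
Proof. by apply: prodr_ge0 => i _; exact: expR_ge0. Qed.

Lemma measurable_tuple_likelihood (h : 'I_n -> R) :
  measurable_fun [set: n.-tuple R] (tuple_likelihood h).
Proof.
apply: measurable_prod => i _.
apply: (measurableT_comp (measurable_likelihood s (h i))).
exact: measurable_tnth.
Qed.

(** The finite-dimensional Cameron-Martin formula. *)
Lemma noise_shift (h : 'I_n -> R) (G : n.-tuple R -> \bar R) :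
  measurable_fun [set: n.-tuple R] G -> (forall y, 0 <= G y)%E ->
  (\int[P]_w G (tshift h (noise w)) =
   \int[P]_w (G (noise w) * (tuple_likelihood h (noise w))%:E))%E.
Proof.
move=> mG G0; have := noise_shift_seq h (index_enum 'I_n) G (index_enum_uniq _) mG G0.
rewrite /tuple_likelihood => <-; apply: eq_integral => w _.
congr (G (tshift _ _)); apply/funext => j.
by rewrite mem_index_enum.
Qed.

Lemma tuple_likelihood_shift (h : 'I_n -> R) (y : n.-tuple R) :
  tuple_likelihood h (tshift h y) =
  tuple_likelihood h y * expR ((\sum_(i < n) h i ^+ 2) / s ^+ 2).
Proof.
rewrite mulr_suml expR_sum -big_split /=; apply: eq_bigr => i _.
rewrite tnth_mktuple /likelihood -expRD; congr expR.
by field.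
Qed.

Lemma tuple_likelihood_mean (h : 'I_n -> R) :
  (\int[P]_w (tuple_likelihood h (noise w))%:E = 1)%E.
Proof.
have := noise_shift h (fun=> 1%E) (measurable_cst _) (fun=> lee01).
under [RHS]eq_integral do rewrite mul1e.
by move=> <-; rewrite (integral_cst P measurableT 1%E) mul1e; exact: probability_setT.
Qed.

(** One factor of the square is absorbed as a change of measure. The other is then evaluated at the
    shifted noise, where [tuple_likelihood_shift] pulls out the exponential and leaves a likelihood
    of mean 1. *)
Lemma tuple_likelihood_second_moment (h : 'I_n -> R) :
  (\int[P]_w (tuple_likelihood h (noise w) ^+ 2)%:E =
   (expR ((\sum_(i < n) h i ^+ 2) / s ^+ 2))%:E)%E.
Proof.
have mL : measurable_fun [set: n.-tuple R] (fun y => (tuple_likelihood h y)%:E : \bar R).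
  by apply/measurable_EFinP; exact: measurable_tuple_likelihood.
have L0 y : (0 <= (tuple_likelihood h y)%:E :> \bar R)%E.
  by rewrite lee_fin tuple_likelihood_ge0.
under eq_integral do rewrite expr2 EFinM.
rewrite -(noise_shift h _ mL L0).
under eq_integral do rewrite tuple_likelihood_shift EFinM.
have mLn := measurableT_comp mL measurable_noise.
rewrite ge0_integralZr//.
by rewrite tuple_likelihood_mean mul1e.
Qed.

(** Le Cam's two-point argument: [a] and [b] are the errors of one estimate against two hypotheses
    at distance [theta], and the bound on [h] keeps the chi-square divergence of the two laws
    bounded. *)
Lemma two_point_risk (h : 'I_n -> R) (a b : n.-tuple R -> R) (theta : R) :
  measurable_fun [set: n.-tuple R] a -> measurable_fun [set: n.-tuple R] b ->
  (forall y, a y - b y = theta) -> \sum_(i < n) h i ^+ 2 <= s ^+ 2 / 2 ->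
  ((theta ^+ 2 / 4)%:E <= \int[P]_w (a (noise w) ^+ 2)%:E +
                          \int[P]_w (b (tshift h (noise w)) ^+ 2)%:E)%E.
Proof.
move=> ma mb ab hs.
have s2 : 0 < s ^+ 2 by rewrite exprn_even_gt0.
have mL := measurable_tuple_likelihood h.
have L0 := tuple_likelihood_ge0 h.
have mE (f : n.-tuple R -> R) : measurable_fun [set: n.-tuple R] f ->
    measurable_fun [set: T] (fun w => (f (noise w))%:E : \bar R).
  by move=> mf; apply/measurable_EFinP; exact: (measurableT_comp mf measurable_noise).
have msq (f : n.-tuple R -> R) : measurable_fun [set: n.-tuple R] f ->
    measurable_fun [set: n.-tuple R] (fun y => f y ^+ 2).
  by move=> mf; exact: measurable_funX.
rewrite (noise_shift h (fun y => (b y ^+ 2)%:E)); last 2 first.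
- by apply/measurable_EFinP; exact: msq.
- by move=> y; rewrite lee_fin sqr_ge0.
have exp_half : expR ((\sum_(i < n) h i ^+ 2) / s ^+ 2) <= 2.
  apply: (@le_trans _ _ (expR 2^-1)).
    by rewrite ler_expR ler_pdivrMr// mulrC.
  (* The bound [1 - 1 / 2 <= expR (- 1 / 2)] inverts to [expR (1 / 2) <= 2]. *)
  have := expR_ge1Dx (- 2^-1 : R); rewrite expRN.
  have := expR_gt0 (2^-1 : R); set e := expR _ => e0.
  rewrite -[1]/(1%R) -(ler_pM2r e0) mulVf ?gt_eqF//; lra.
(* The likelihood L has mean 1 and second moment at most 2, so integrating this
   inequality leaves [3 / 4 - 2 / 4] times [theta ^+ 2]. *)
have pointwise y : 3 / 4 * theta ^+ 2 * tuple_likelihood h y <=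
    a y ^+ 2 + b y ^+ 2 * tuple_likelihood h y +
    theta ^+ 2 / 4 * tuple_likelihood h y ^+ 2.
  rewrite -(ab y); have := L0 y.
  set L := tuple_likelihood h y; set u := a y; set v := b y => Lge0.
  have L1 : 0 < 1 + L by rewrite ltr_wpDr.
  rewrite -subr_ge0 -(pmulr_lge0 _ L1).
  set z := (X in 0 <= X).
  (* For a fixed difference [u - v], the minimum of [u ^+ 2 + L * v ^+ 2] is
     [(u - v) ^+ 2 * L / (1 + L)], attained where [u + L * v] vanishes; clearing [1 + L] leaves two
     nonnegative terms. *)
  have -> : z = (u + L * v) ^+ 2 + (u - v) ^+ 2 * (L * (L - 1) ^+ 2 / 4).
    by rewrite /z; field.
  apply: addr_ge0; first exact: sqr_ge0.
  apply: mulr_ge0; first exact: sqr_ge0.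
  by apply: divr_ge0 => //; apply: mulr_ge0 => //; exact: sqr_ge0.
have t34 : 0 <= 3 / 4 * theta ^+ 2 by rewrite mulr_ge0 ?sqr_ge0// divr_ge0.
have t4 : 0 <= theta ^+ 2 / 4 by rewrite divr_ge0 ?sqr_ge0.
have mL2 := msq _ mL.
have ma2 := msq _ ma.
have mb2L := measurable_funM (msq _ mb) mL.
have nA w : [set: T] w -> (0 <= (a (noise w) ^+ 2)%:E :> \bar R)%E.
  by move=> _; rewrite lee_fin sqr_ge0.
have nB w : [set: T] w ->
    (0 <= (b (noise w) ^+ 2 * tuple_likelihood h (noise w))%:E :> \bar R)%E.
  by move=> _; rewrite lee_fin mulr_ge0 ?sqr_ge0 ?L0.
have nL w : [set: T] w -> (0 <= (tuple_likelihood h (noise w))%:E :> \bar R)%E.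
  by move=> _; rewrite lee_fin L0.
have nL2 w : [set: T] w -> (0 <= (tuple_likelihood h (noise w) ^+ 2)%:E :> \bar R)%E.
  by move=> _; rewrite lee_fin sqr_ge0.
have nAB w : [set: T] w -> (0 <= (a (noise w) ^+ 2 +
    b (noise w) ^+ 2 * tuple_likelihood h (noise w))%:E :> \bar R)%E.
  by move=> wT; rewrite EFinD adde_ge0 ?nA ?nB.
have nC w : [set: T] w ->
    (0 <= (theta ^+ 2 / 4 * tuple_likelihood h (noise w) ^+ 2)%:E :> \bar R)%E.
  by move=> _; rewrite lee_fin mulr_ge0 ?sqr_ge0.
have mAB := measurable_funD ma2 mb2L.
have mC : measurable_fun [set: n.-tuple R]
    (fun y => theta ^+ 2 / 4 * tuple_likelihood h y ^+ 2).
  exact: measurable_funM.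
have : (\int[P]_w (3 / 4 * theta ^+ 2 * tuple_likelihood h (noise w))%:E <=
  \int[P]_w (a (noise w) ^+ 2 + b (noise w) ^+ 2 * tuple_likelihood h (noise w) +
    theta ^+ 2 / 4 * tuple_likelihood h (noise w) ^+ 2)%:E)%E.
  apply: ge0_le_integral => //.
  - by move=> w _; rewrite lee_fin mulr_ge0.
  - by apply: (mE (fun y => 3 / 4 * theta ^+ 2 * tuple_likelihood h y)); apply: measurable_funM.
  - exact: (mE _ (measurable_funD mAB mC)).
  - by move=> w _; rewrite lee_fin pointwise.
under eq_integral do rewrite EFinM.
rewrite (ge0_integralZl_EFin P measurableT nL (mE _ mL) t34).
rewrite tuple_likelihood_mean mule1.
under [leRHS]eq_integral do rewrite EFinD.
rewrite (ge0_integralD P measurableT nAB (mE _ mAB) nC (mE _ mC)).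
under [in X in (X + _)%E]eq_integral do rewrite EFinD.
rewrite (ge0_integralD P measurableT nA (mE _ ma2) nB (mE _ mb2L)).
under [in X in (_ + X)%E]eq_integral do rewrite EFinM.
rewrite (ge0_integralZl_EFin P measurableT nL2 (mE _ mL2) t4).
rewrite tuple_likelihood_second_moment -EFinM -leeBlDr// -EFinB.
under [in X in (_ + X)%E]eq_integral do rewrite EFinM.
apply: le_trans; rewrite lee_fin.
have := sqr_ge0 theta; nra.
Qed.
End GaussianShift.

(** * Assouad's lemma *)

(** Expands the square of [W v - p], which is [W] times the residual of [v] after projection onto
    the span of the [psi r]. *)
Lemma bessel_inequality (R : realFieldType) (n : nat) (B : finType) (S : {set B})
    (psi : B -> 'I_n -> R) (W : R) (v : 'I_n -> R) : 0 < W ->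
  (forall r, r \in S -> \sum_i psi r i ^+ 2 = W) ->
  (forall r r', r \in S -> r' \in S -> r != r' ->
     \sum_i psi r i * psi r' i = 0) ->
  \sum_(r in S) (\sum_i psi r i * v i) ^+ 2 <= W * \sum_i v i ^+ 2.
Proof.
move=> W0 norm orth; pose c r := \sum_i psi r i * v i.
pose p i := \sum_(r in S) c r * psi r i.
have vp : \sum_i v i * p i = \sum_(r in S) c r ^+ 2.
  under eq_bigr do rewrite mulr_sumr.
  rewrite exchange_big; apply: eq_bigr => r _.
  by rewrite expr2 [X in _ = _ * X]/c mulr_sumr; apply: eq_bigr => i _; ring.
have pp : \sum_i p i ^+ 2 = W * \sum_(r in S) c r ^+ 2.
  transitivity (\sum_i \sum_(r in S) \sum_(r' in S) c r * c r' * (psi r i * psi r' i)).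
    apply: eq_bigr => i _; rewrite expr2 {1}/p mulr_suml; apply: eq_bigr => r _.
    by rewrite /p mulr_sumr; apply: eq_bigr => r' _; ring.
  rewrite exchange_big mulr_sumr; apply: eq_bigr => r rS.
  rewrite exchange_big (bigD1 r)//= [X in _ + X]big1 ?addr0; last first.
    move=> r' /andP[r'S r'r]; rewrite -mulr_sumr orth ?mulr0//.
    by rewrite eq_sym.
  rewrite -mulr_sumr -expr2 mulrC -(norm r rS); congr (_ * _).
have : 0 <= \sum_i (W * v i - p i) ^+ 2 by apply: sumr_ge0 => i _; exact: sqr_ge0.
have -> : \sum_i (W * v i - p i) ^+ 2 =
    W ^+ 2 * \sum_i v i ^+ 2 - 2 * W * \sum_i v i * p i + \sum_i p i ^+ 2.
  rewrite !mulr_sumr -sumrN -!big_split /=.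
  by apply: eq_bigr => i _; ring.
rewrite vp pp => h; rewrite -(ler_pM2l W0) -subr_ge0; apply: le_trans h _.
rewrite le_eqVlt; apply/orP; left; apply/eqP; ring.
Qed.

Definition setbit {B : finType} (e : {ffun B -> bool}) (r : B) (b : bool) :
  {ffun B -> bool} := [ffun r' => if r' == r then b else e r'].

Lemma setbit_id {B : finType} (e : {ffun B -> bool}) (r : B) : setbit e r (e r) = e.
Proof. by apply/ffunP => r'; rewrite ffunE; case: eqP => // ->. Qed.

Lemma setbitK {B : finType} (r : B) :
  involutive (fun e : {ffun B -> bool} => setbit e r (~~ e r)).
Proof.
by move=> e; apply/ffunP => r'; rewrite !ffunE eqxx negbK; case: eqP => // ->.
Qed.

Section Assouad.
Context {R : realType} {disp : measure_display} {T : measurableType disp}.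
Variables (P : probability T R) (d n : nat) (xi : 'I_n -> {RV P >-> R}) (s : R).
Hypotheses (s0 : s != 0) (xi_iid : iid_normal s xi).
Variables (x : 'I_n -> {ffun 'I_d -> R}) (B : finType) (S : {set B}).
Variables (f : {ffun B -> bool} -> {ffun 'I_d -> R} -> R) (psi : B -> 'I_n -> R).
Variables (W Theta V : R).
Hypotheses (n0 : (0 < n)%N) (x_cube : forall i, unit_cube (x i)) (W0 : 0 < W).
Hypothesis psi_norm : forall r, r \in S -> \sum_i psi r i ^+ 2 = W.
Hypothesis psi_orth : forall r r', r \in S -> r' \in S -> r != r' ->
  \sum_i psi r i * psi r' i = 0.
Hypothesis fV : forall e, (HK0_variation (f e) <= V%:E)%E.
Let delta (e : {ffun B -> bool}) (r : B) (i : 'I_n) : R :=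
  f (setbit e r true) (x i) - f (setbit e r false) (x i).
Hypothesis delta_small : forall e r, r \in S ->
  \sum_i delta e r i ^+ 2 <= s ^+ 2 / 2.
Hypothesis psi_delta : forall e r, r \in S -> \sum_i psi r i * delta e r i = Theta.

Section OneEstimator.
Variable fhat : n.-tuple R -> {ffun 'I_d -> R} -> R.
Hypothesis fhat_est : estimator fhat.

Let coef (r : B) (e : {ffun B -> bool}) (y : n.-tuple R) : R :=
  \sum_i psi r i * (fhat y (x i) - f e (x i)).
Let obs e := observations x xi (f e).

Let obsE e w : obs e w = tshift (fun i => f e (x i)) [tuple xi i w | i < n].
Proof. by apply: eq_from_tnth => i; rewrite !tnth_mktuple addrC. Qed.

Let measurable_obs e : measurable_fun [set: T] (obs e).
Proof.
rewrite (_ : obs e = tshift (fun i => f e (x i)) \o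
  (fun w => [tuple xi i w | i < n])); last by apply/funext => w; rewrite obsE.
exact: measurableT_comp (measurable_tshift _) measurable_noise.
Qed.

Let measurable_coef r e : measurable_fun [set: n.-tuple R] (coef r e).
Proof.
apply: measurable_sum => i; apply: measurable_funM => //.
apply: measurable_funB => //; exact: fhat_est.
Qed.

Let bit_risk e r : \bar R := (\int[P]_w (coef r e (obs e w) ^+ 2)%:E)%E.

(** Recentring the observations at the hypothesis with bit [r] off turns the other hypothesis into
    noise shifted by [delta e r], so [two_point_risk] applies. *)
Lemma two_bit_risk e r : r \in S ->
  ((Theta ^+ 2 / 4)%:E <= bit_risk (setbit e r false) r + bit_risk (setbit e r true) r)%E.
Proof.
move=> rS; set f0 := setbit e r false; set f1 := setbit e r true.
pose a y := coef r f0 (tshift (fun i => f f0 (x i)) y).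
pose b y := coef r f1 (tshift (fun i => f f0 (x i)) y).
have mt := measurable_tshift (fun i : 'I_n => f f0 (x i)).
have ab y : a y - b y = Theta.
  rewrite -(psi_delta e r rS) /a /b /coef -sumrB.
  by apply: eq_bigr => i _; rewrite /delta -/f0 -/f1; ring.
have := @two_point_risk R disp T P n xi s s0 xi_iid (delta e r) a b Theta
  (measurableT_comp (measurable_coef r f0) mt)
  (measurableT_comp (measurable_coef r f1) mt) ab (delta_small e r rS).
move=> /le_trans; apply; rewrite le_eqVlt; apply/orP; left; apply/eqP.
congr (_ + _)%E; apply: eq_integral => w _; rewrite obsE//.
congr ((coef r f1 _) ^+ 2)%:E; apply: eq_from_tnth => i; rewrite !tnth_mktuple.
by rewrite /delta -/f0 -/f1; ring.
Qed.

(** Bessel's inequality, pointwise in the noise: the total squared error dominates the errors along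
    the separate directions [psi r]. *)
Lemma loss_ge_bit_risk e :
  ((\sum_(r in S) (n%:R * W)^-1%:E * bit_risk e r) <=
    'E_P[fun w => loss x (fhat (obs e w)) (f e)])%E.
Proof.
have k0 : 0 <= (n%:R * W)^-1 by rewrite invr_ge0 mulr_ge0// ltW.
have mc r : measurable_fun [set: T] (fun w => (coef r e (obs e w) ^+ 2)%:E : \bar R).
  apply/measurable_EFinP/measurable_funX.
  exact: measurableT_comp (measurable_coef r e) (measurable_obs e).
rewrite expectation.unlock.
under eq_bigr => r _.
  rewrite -(ge0_integralZl_EFin P measurableT _ (mc r) k0); last first.
    by move=> w _; rewrite lee_fin sqr_ge0.
  over.
have mkc r : measurable_fun [set: T]
    (fun w => ((n%:R * W)^-1%:E * (coef r e (obs e w) ^+ 2)%:E)%E : \bar R).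
  exact: measurable_funeM.
have kc0 r w : [set: T] w -> (0 <= (n%:R * W)^-1%:E * (coef r e (obs e w) ^+ 2)%:E)%E.
  by move=> _; rewrite mule_ge0 ?lee_fin ?sqr_ge0.
rewrite -big_enum -(ge0_integral_sum P measurableT mkc kc0).
apply: ge0_le_integral => //.
- by move=> w _; apply: sume_ge0 => r _; exact: kc0.
- exact: emeasurable_sum.
- apply/measurable_EFinP; apply: measurable_funM => //.
  apply: measurable_sum => i; apply: measurable_funX; apply: measurable_funB => //.
  exact: measurableT_comp (fhat_est _ (x_cube i)) (measurable_obs e).
- move=> w _; rewrite big_enum; under eq_bigr do rewrite -EFinM.
  rewrite sumEFin lee_fin -mulr_sumr /loss invfM -mulrA.
  rewrite ler_wpM2l ?invr_ge0// ler_pdivrMl//.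
  exact: bessel_inequality.
Qed.

Lemma assouad_estimator (M : \bar R) :
  (forall e, ('E_P[fun w => loss x (fhat (obs e w)) (f e)] <= M)%E) ->
  ((#|S|%:R * Theta ^+ 2 / (8 * W * n%:R))%:E <= M)%E.
Proof.
move=> leM.
have nW0 : 0 < n%:R * W by rewrite mulr_gt0// ltr0n.
set k := (n%:R * W)^-1.
have k0 : 0 <= k by rewrite invr_ge0 ltW.
have br0 e r : (0 <= bit_risk e r)%E.
  by apply: integral_ge0 => w _; rewrite lee_fin sqr_ge0.
have low : ((\sum_(e : {ffun B -> bool}) \sum_(r in S) (k * (Theta ^+ 2 / 4)))%:E <=
   \sum_(e : {ffun B -> bool}) (M + M))%E.
  (* The bit risks are summed twice; in the second copy [e] is reindexed by flipping bit [r], which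
     pairs each term with its flip. *)
  apply: (@le_trans _ _ (\sum_(e : {ffun B -> bool})
      (\sum_(r in S) k%:E * bit_risk e r + \sum_(r in S) k%:E * bit_risk e r))%E); last first.
    by apply: lee_sum => e _; apply: leeD; apply: le_trans (loss_ge_bit_risk e) (leM e).
  rewrite big_split /= [X in (_ + X)%E]exchange_big /=.
  rewrite [X in (_ + X)%E](eq_bigr (fun r =>
    \sum_(e : {ffun B -> bool}) k%:E * bit_risk (setbit e r (~~ e r)) r))%E; last first.
    by move=> r _; rewrite (reindex_inj (inv_inj (setbitK r))).
  rewrite [X in (_ + X)%E]exchange_big /= -big_split /= -sumEFin; apply: lee_sum => e _.
  rewrite -big_split /= -sumEFin; apply: lee_sum => r rS.
  rewrite EFinM -ge0_muleDr//; apply: lee_wpmul2l => //.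
  have := two_bit_risk e r rS; rewrite -[in X in _ -> (_ <= X + _)%E](setbit_id e r).
  by case: (e r) => //=; rewrite addeC.
move: leM low; case: M => [m| |] leM; last 2 first.
- by rewrite leey.
(* A risk is nonnegative, so [M] cannot be [-oo]. *)
- have /le_trans/(_ (leM [ffun=> true])) : (0 <= 'E_P[fun w =>
      loss x (fhat (obs [ffun=> true] w)) (f [ffun=> true])])%E.
    rewrite expectation.unlock; apply: integral_ge0 => w _; rewrite lee_fin mulr_ge0//.
    by apply: sumr_ge0 => i _; exact: sqr_ge0.
  by [].
rewrite -EFinD sumEFin !lee_fin !sumr_const -[leLHS]mulr_natr -[leRHS]mulr_natr.
rewrite ler_pM2r; last by rewrite ltr0n; apply/card_gt0P; exists [ffun=> true].
move=> low; rewrite -(ler_pM2l (_ : 0 < 2))// mulr2n mulrDl mul1r [in leRHS]mulrDl mul1r.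
apply: le_trans low; rewrite le_eqVlt; apply/orP; left; apply/eqP.
rewrite /k -mulr_natr; field.
by rewrite gt_eqF// pnatr_eq0 -lt0n n0.
Qed.

End OneEstimator.

(** Flipping a bit moves the coordinate along [psi r] by exactly [Theta], whatever the other bits
    are. Each bit thus costs a two-point error, and orthogonality lets these costs add up. *)
Lemma assouad :
  ((#|S|%:R * Theta ^+ 2 / (8 * W * n%:R))%:E <= minimax_risk x xi V)%E.
Proof.
apply: le_ereal_inf_tmp => _ [fhat fhat_est <-].
apply: (assouad_estimator fhat fhat_est) => e.
by apply: ereal_sup_ubound; exists (f e) => //; exact: fV.
Qed.

End Assouad.

(** * Hardy-Krause variation of step functions *)

Lemma natr_forall {R : comPzRingType} {I : finType} (b : I -> bool) :
  [forall i, b i]%:R = \prod_i (b i)%:R :> R.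
Proof.
case: forallP => [h|/forallP/forallPn[i /negPf hi]].
  by rewrite big1// => i _; rewrite h.
by rewrite (bigD1 i)//= hi mul0r.
Qed.

Section StepFunctions.
Context {R : realType} {I : finType}.

Definition orthant (z u : {ffun I -> R}) : bool := [forall i, z i <= u i].

Lemma orthantE (z u : {ffun I -> R}) :
  (orthant z u)%:R = \prod_i (z i <= u i)%R%:R :> R.
Proof. exact: natr_forall. Qed.

(** No side is degenerate, so every vertex occurs and the alternating sum is the expanded
    product. *)
Lemma quasi_volume_prod (h : I -> R -> R) (a b : {ffun I -> R}) :
  (forall i, a i != b i) ->
  quasi_volume (fun u => \prod_i h i (u i)) a b = \prod_i (h i (b i) - h i (a i)).
Proof.
move=> ab; rewrite /quasi_volume.
have allP (j : {ffun I -> bool}) : [forall i, j i ==> (a i != b i)] = true.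
  by apply/forallP => i; rewrite ab implybT.
rewrite [LHS](eq_bigl (fun=> true)) => [|j]; last exact: allP.
under [RHS]eq_bigr => i _.
  rewrite (_ : _ - _ = \sum_(c : bool) (-1) ^+ c * h i (b i + c%:R * (a i - b i))).
    over.
  by rewrite big_bool /= mul1r mul0r addr0 expr1 expr0 mul1r mulN1r addrC addrCA subrr addr0.
rewrite bigA_distr_bigA /=; apply: eq_bigr => j _.
rewrite big_split /= prodrXr; congr (_ * _).
by apply: eq_bigr => i _; rewrite ffunE.
Qed.

Lemma quasi_volume_sum (Z : finType) (mu : Z -> R) (g : Z -> {ffun I -> R} -> R)
    (a b : {ffun I -> R}) :
  quasi_volume (fun u => \sum_z mu z * g z u) a b =
  \sum_z mu z * quasi_volume (g z) a b.
Proof.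
rewrite /quasi_volume; under eq_bigr do rewrite mulr_sumr.
rewrite exchange_big; apply: eq_bigr => z _; rewrite mulr_sumr.
by apply: eq_bigr => j _; rewrite mulrCA.
Qed.

Lemma itv_partition_lt (p : seq R) (k : 'I_(size p)) :
  itv_partition 0 1 p -> nth 0 (0 :: p) k < nth 0 p k.
Proof.
move=> [/pathP h _]; have := h 0 k (ltn_ord k).
by [].
Qed.

(** Cells are taken half-open because a step at [z] jumps across the cell whose left end is below
    [z] and whose right end is not. *)
Lemma itv_partition_cell_inj (p : seq R) (k l : 'I_(size p)) (z : R) :
  itv_partition 0 1 p ->
  nth 0 (0 :: p) k < z <= nth 0 p k -> nth 0 (0 :: p) l < z <= nth 0 p l -> k = l.
Proof.
move=> [hp _].
have sp : sorted <=%R (0 :: p).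
  by apply: (@sub_sorted _ (<%R : rel R) _ _ (0 :: p) hp) => a b; exact: ltW.
wlog kl : k l / (k <= l)%N.
  move=> hw; case: (leqP k l) => [kl|/ltnW lk] h1 h2; first exact: hw.
  by apply/esym; exact: hw.
move=> /andP[_ zk] /andP[lz _]; apply: val_inj => /=.
apply/eqP; rewrite eqn_leq kl /= leqNgt; apply/negP => kl'.
have : nth 0 (0 :: p) k.+1 <= nth 0 (0 :: p) l.
  apply: (sorted_leq_nth le_trans (lexx (T := R))) => //=; rewrite inE /= ltnS.
  - exact: ltn_ord.
  - exact: ltnW.
by rewrite /= leNgt (lt_le_trans lz zk).
Qed.

(** The quasi-volume of an orthant indicator is 1 on the half-open cell containing [z] and 0 on the
    others, and there is at most one such cell. *)
Lemma split_sum_orthant (z : {ffun I -> R}) (p : I -> seq R) :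
  (forall i, itv_partition 0 1 (p i)) ->
  split_sum (fun u => (orthant z u)%:R) p <= 1.
Proof.
move=> hp; pose cell (l : {dffun forall i : I, 'I_(size (p i))}) :=
  [forall i, nth 0 (0 :: p i) (l i) < z i <= nth 0 (p i) (l i)].
have volE (l : {dffun forall i : I, 'I_(size (p i))}) : `|quasi_volume (fun u => (orthant z u)%:R)
    [ffun i => nth 0 (0 :: p i) (l i)] [ffun i => nth 0 (p i) (l i)]| = (cell l)%:R.
  rewrite (_ : (fun u => _) = (fun u : {ffun I -> R} => \prod_i (z i <= u i)%R%:R)); last first.
    by apply/funext => u; rewrite orthantE.
  rewrite (quasi_volume_prod (fun i t => (z i <= t)%R%:R)); last first.
    by move=> i; rewrite !ffunE lt_eqF// itv_partition_lt.
  rewrite (_ : \prod_i _ =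
      \prod_i (nth 0 (0 :: p i) (l i) < z i <= nth 0 (p i) (l i))%R%:R); last first.
    apply: eq_bigr => i _; rewrite !ffunE.
    have := itv_partition_lt (p i) (l i) (hp i).
    set a := nth 0 (0 :: p i) (l i); set b := nth 0 (p i) (l i) => ab.
    case: (ltP a (z i)) => /= az; first by rewrite subr0.
    by rewrite (le_trans az (ltW ab)) subrr.
  by rewrite -natr_forall normr_nat.
rewrite /split_sum (eq_bigr _ (fun l _ => volE l)).
have [/existsP[l0 cl0]|/existsPn nocell] := boolP [exists l, cell l]; last first.
  by rewrite big1// => l _; rewrite (negPf (nocell l)).
rewrite (bigD1 l0)//= cl0 big1 ?addr0// => l ll0.
case: (boolP (cell l)) => // cl; case/eqP: ll0.
apply/ffunP => i; apply: (@itv_partition_cell_inj (p i) _ _ (z i)) => //.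
  by move/forallP : cl; exact.
by move/forallP : cl0; exact.
Qed.

Lemma vitali_variation_step (Z : finType) (mu : Z -> R) (a : Z -> {ffun I -> R}) :
  (vitali_variation (fun u => \sum_z mu z * (orthant (a z) u)%:R)%R
     <= (\sum_z `|mu z|)%R%:E)%E.
Proof.
apply: ge_ereal_sup => _ [p hp <-]; rewrite lee_fin /split_sum.
under eq_bigr do rewrite quasi_volume_sum.
apply: (@le_trans _ _ (\sum_(l : {dffun forall s : I, 'I_(size (p s))}) \sum_z `|mu z| *
    `|quasi_volume (fun u => (orthant (a z) u)%:R)
        [ffun i => nth 0 (0 :: p i) (l i)] [ffun i => nth 0 (p i) (l i)]|)).
  apply: ler_sum => l _; apply: le_trans (ler_norm_sum _ _ _) _.
  by apply: ler_sum => z _; rewrite normrM.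
rewrite exchange_big; apply: ler_sum => z _.
by rewrite -mulr_sumr ler_piMr// split_sum_orthant.
Qed.

End StepFunctions.

(** All atoms have positive coordinates, so the function vanishes on every proper face through the
    origin and only the full-dimensional Vitali variation remains. *)
Lemma HK0_variation_step (R : realType) (d : nat) (Z : finType) (mu : Z -> R)
    (a : Z -> {ffun 'I_d -> R}) : (forall z j, 0 < a z j) ->
  (HK0_variation (fun u : {ffun 'I_d -> R} => \sum_z mu z * (orthant (a z) u)%:R)%R
     <= (\sum_z `|mu z|)%R%:E)%E.
Proof.
move=> a0; set F := (fun u => _).
have mu0 : (0 <= (\sum_z `|mu z|)%R%:E)%E by rewrite lee_fin sumr_ge0.
have proper (S : {set 'I_d}) : S != finset.setTfor 'I_d ->
    (vitali_variation (@face_restriction R d F S) <= 0)%E.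
  move=> ST; have [j jS] : exists j, j \notin S.
    apply/existsP; apply: contraNT ST => /existsPn h; apply/eqP/setP => j.
    by rewrite inE; have := h j; rewrite negbK.
  (* The zero function, written as a step function without atoms. *)
  rewrite (_ : @face_restriction R d F S = (fun u => \sum_(z < 0) 0 * (orthant [ffun=> 0] u)%:R)).
    by apply: le_trans (vitali_variation_step _ _ _) _; rewrite big_ord0.
  apply/funext => u; rewrite big_ord0 /face_restriction /F big1// => z _.
  rewrite (_ : orthant _ _ = false) ?mulr0//; apply/forallP => /(_ j).
  by rewrite ffunE insubN//= leNgt a0.
have full : (vitali_variation (@face_restriction R d F (finset.setTfor 'I_d))
    <= (\sum_z `|mu z|)%R%:E)%E.
  pose a' z : {ffun {j : 'I_d | j \in finset.setTfor 'I_d} -> R} := [ffun j => a z (val j)].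
  rewrite (_ : @face_restriction R d F (finset.setTfor 'I_d) =
      (fun u => \sum_z mu z * (orthant (a' z) u)%:R)).
    exact: vitali_variation_step.
  apply/funext => u; rewrite /face_restriction /F; apply: eq_bigr => z _.
  congr (_ * (nat_of_bool _)%:R); apply/forallP/forallP => h j.
    by have := h (val j); rewrite !ffunE valK.
  have jT : j \in finset.setTfor 'I_d by rewrite inE.
  by have := h (Sub j jT); rewrite !ffunE insubT.
rewrite /HK0_variation.
(* When [d = 0] the full index set is empty and is left out of the sum. *)
have [T0|T0] := eqVneq (finset.setTfor 'I_d) finset.set0; last first.
  rewrite (bigD1 (finset.setTfor 'I_d))//= -[leRHS]adde0; apply: leeD => //.
  by apply: sume_le0 => S /andP[_]; exact: proper.
by apply: le_trans mu0; apply: sume_le0 => S; rewrite -T0; exact: proper.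
Qed.

(** * Waves in one dimension *)

Section Blocks.
Context {R : realType}.
Implicit Types (F G q : nat -> R) (pat : nat -> R) (v w l M a b p r : nat).

Lemma sum_blocks F M w :
  \sum_(p < M * w) F p = \sum_(a < M) \sum_(r < w) F (a * w + r)%N.
Proof.
elim: M => [|M IHM]; first by rewrite mul0n !big_ord0.
by rewrite mulSnr big_split_ord big_ord_recr /= IHM.
Qed.

Lemma sum_quarters F v a :
  \sum_(r < 4 * v) F (a * (4 * v) + r)%N =
  \sum_(b < 4) \sum_(r < v) F ((4 * a + b) * v + r)%N.
Proof.
rewrite (sum_blocks (fun r => F (a * (4 * v) + r)%N)).
by apply: eq_bigr => b _; apply: eq_bigr => r _; congr F; lia.
Qed.

Lemma block_div v a r : (r < v)%N -> ((a * v + r) %/ v)%N = a.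
Proof.
by move=> rv; rewrite divnMDl ?(leq_ltn_trans _ rv)// divn_small ?addn0.
Qed.

Lemma block_div4 v a b r : (r < v)%N -> (b < 4)%N ->
  (((4 * a + b) * v + r) %/ (4 * v))%N = a.
Proof. by move=> rv b4; rewrite (mulnC 4 v) divnMA block_div// (mulnC 4 a) block_div. Qed.

(* Supported on [4 l v, 4 (l + 1) v), with value [pat b] on its [b]-th quarter. *)
Definition wave pat v l p : R := (p %/ (4 * v) == l)%N%:R * pat ((p %/ v) %% 4)%N.

Lemma sum_wave pat F v M l : (l < M)%N ->
  \sum_(p < M * (4 * v)) wave pat v l p * F p =
  \sum_(b < 4) pat b * \sum_(r < v) F ((4 * l + b) * v + r)%N.
Proof.
move=> lM; rewrite (sum_blocks (fun p => wave pat v l p * F p)).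
under eq_bigr do rewrite (sum_quarters (fun p => wave pat v l p * F p)).
have waveE a (b : 'I_4) (r : 'I_v) :
    wave pat v l ((4 * a + b) * v + r)%N = (a == l)%:R * pat b.
  rewrite /wave block_div4// block_div// mulnC modnMDl modn_small//.
rewrite (bigD1 (Ordinal lM))//= [X in _ + X]big1 ?addr0; last first.
  move=> a al; rewrite big1// => b _; rewrite big1// => r _.
  have aln : (nat_of_ord a == l) = false by apply: negbTE.
  by rewrite waveE aln !mul0r.
apply: eq_bigr => b _; rewrite mulr_sumr; apply: eq_bigr => r _.
by rewrite waveE eqxx mul1r.
Qed.

Definition mean_zero pat := \sum_(b < 4) pat b = 0.

(** The interval of the finer wave lies in one quarter of the coarser grid, where the coarser wave
    is constant, so the sum is a multiple of the mean of [pat']. *)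
Lemma wave_orth_fine pat pat' v v' l l' M M' :
  mean_zero pat' -> (M * (4 * v) = M' * (4 * v'))%N ->
  (4 * v' %| v)%N -> (0 < v')%N -> (l' < M')%N ->
  \sum_(p < M * (4 * v)) wave pat v l p * wave pat' v' l' p = 0.
Proof.
move=> pat0 -> /dvdnP[x vE] v'0 l'M'.
under eq_bigr do rewrite mulrC.
rewrite sum_wave//.
have coarse (b : 'I_4) (r : 'I_v') : wave pat v l ((4 * l' + b) * v' + r) =
    (l' %/ x %/ 4 == l)%N%:R * pat ((l' %/ x) %% 4)%N.
  rewrite /wave (mulnC 4 v) divnMA vE (mulnC x) divnMA block_div4//.
under eq_bigr => b _ do (under eq_bigr => r _ do rewrite coarse).
under eq_bigr do rewrite sumr_const.
by rewrite -mulr_suml pat0 mul0r.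
Qed.

Lemma wave_orth_same pat pat' v l l' p : l != l' -> wave pat v l p * wave pat' v l' p = 0.
Proof.
move=> ll'; rewrite /wave; case: (eqVneq (p %/ (4 * v))%N l) => [->|_]; last by rewrite !mul0r.
by rewrite (negPf ll') mul0r mulr0.
Qed.

Lemma sum_wave_sqr pat v M l : (forall b, pat b ^+ 2 = 1) -> (l < M)%N ->
  \sum_(p < M * (4 * v)) wave pat v l p ^+ 2 = (4 * v)%:R.
Proof.
move=> pat1 lM.
under eq_bigr do rewrite expr2.
rewrite (sum_wave pat (wave pat v l))//.
under eq_bigr => b _ do under eq_bigr => r _ do
  rewrite /wave block_div4// eqxx mul1r block_div// (mulnC 4) modnMDl modn_small//.
under eq_bigr do rewrite sumr_const card_ord -mulr_natr mulrA -expr2 pat1 mul1r.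
by rewrite sumr_const card_ord -[_ *+ 4]mulr_natr -natrM mulnC.
Qed.

Definition convex_pattern b : R := if (b == 0)%N || (b == 3)%N then 1 else -1.
Definition haar_pattern b : R := if (b < 2)%N then 1 else -1.

Lemma convex_pattern_mean : mean_zero convex_pattern.
Proof. by rewrite /mean_zero !big_ord_recl big_ord0 /convex_pattern /=; ring. Qed.

Lemma haar_pattern_mean : mean_zero haar_pattern.
Proof. by rewrite /mean_zero !big_ord_recl big_ord0 /haar_pattern /=; ring. Qed.

Lemma convex_pattern_sqr b : convex_pattern b ^+ 2 = 1.
Proof. by rewrite /convex_pattern; case: ifP; rewrite ?sqrrN expr1n. Qed.

Lemma haar_pattern_sqr b : haar_pattern b ^+ 2 = 1.
Proof. by rewrite /haar_pattern; case: ifP; rewrite ?sqrrN expr1n. Qed.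

(* A weight with the moments of the constant 1 up to order one on each block of
   length [v]: multiplying a wave by it does not change the pairing of its
   primitive with the Haar function. *)
Definition balanced v M q := forall a, (a < M)%N ->
  \sum_(r < v) q (a * v + r)%N = v%:R /\
  \sum_(r < v) q (a * v + r)%N * r%:R = \sum_(r < v) r%:R.

Lemma balanced1 v M : balanced v M (fun=> 1).
Proof.
move=> a _; split; first by rewrite sumr_const card_ord.
by apply: eq_bigr => r _; rewrite mul1r.
Qed.

(** The perturbation is constant on each quarter, where [q] has the moments of 1. The pattern has
    sum [1 - 1 - 1 + 1 = 0] and first moment [0 - 1 - 2 + 3 = 0], so it drops out of both
    moments. *)
Lemma balanced_riesz v M q (e : nat -> R) : balanced v (4 * M) q ->
  balanced (4 * v) M
    (fun p => (1 + e (p %/ (4 * v))%N * convex_pattern ((p %/ v) %% 4)%N) * q p).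
Proof.
move=> qbal a aM.
have inner (b : 'I_4) (r : 'I_v) :
    (1 + e (((4 * a + b) * v + r) %/ (4 * v))%N *
      convex_pattern ((((4 * a + b) * v + r) %/ v) %% 4)%N) =
    1 + e a * convex_pattern b.
  by rewrite block_div4// block_div// (mulnC 4) modnMDl modn_small.
have bnd (b : 'I_4) : (4 * a + b < 4 * M)%N by have := ltn_ord b; lia.
split.
  rewrite (sum_quarters (fun p => (1 + e (p %/ (4 * v))%N *
    convex_pattern ((p %/ v) %% 4)%N) * q p)).
  under eq_bigr => b _ do
    (under eq_bigr do rewrite inner; rewrite -mulr_sumr (qbal _ (bnd b)).1).
  by rewrite !big_ord_recl big_ord0 /convex_pattern /=; ring.
rewrite (sum_blocks (fun r => (1 + e ((a * (4 * v) + r) %/ (4 * v))%N *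
    convex_pattern (((a * (4 * v) + r) %/ v) %% 4)%N) * q (a * (4 * v) + r)%N * r%:R)).
rewrite (sum_blocks (fun r => r%:R)).
have tail (b : 'I_4) : \sum_(r < v) (b * v + r)%N%:R =
    b%:R * v%:R ^+ 2 + \sum_(r < v) r%:R :> R.
  under eq_bigr do rewrite natrD.
  by rewrite big_split /= sumr_const card_ord -[_ *+ v]mulr_natr natrM; ring.
under [RHS]eq_bigr do rewrite tail.
have head (b : 'I_4) : \sum_(r < v) (1 + e ((a * (4 * v) + (b * v + r)) %/ (4 * v))%N *
    convex_pattern (((a * (4 * v) + (b * v + r)) %/ v) %% 4)%N) *
      q (a * (4 * v) + (b * v + r))%N * (b * v + r)%N%:R =
   (1 + e a * convex_pattern b) * (b%:R * v%:R ^+ 2 + \sum_(r < v) r%:R).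
  have idx (r : nat) : (a * (4 * v) + (b * v + r) = (4 * a + b) * v + r)%N by lia.
  under eq_bigr do rewrite idx inner natrD -mulrA mulrDr natrM.
  rewrite -mulr_sumr big_split /= -mulr_suml (qbal _ (bnd b)).1 (qbal _ (bnd b)).2.
  by congr (_ * _); ring.
etransitivity; first by apply: eq_bigr => b _; exact: head.
rewrite !big_ord_recl !big_ord0 /convex_pattern /= /fintype.bump /=; ring.
Qed.

Section Primitive.
Variables (v M l : nat) (q : nat -> R).
Hypotheses (v0 : (0 < v)%N) (lM : (l < M)%N).
Hypotheses (q0 : forall p, 0 <= q p) (qbal : balanced v (4 * M) q).

(** The inequality is strict because the atom of index [p] will sit at coordinate [p.+1]. *)
Definition primitive_wave (c : nat) : R :=
  \sum_(p < M * (4 * v)) wave convex_pattern v l p * (q p * (p < c)%N%:R).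

Let Q b s := \sum_(r < v) q ((4 * l + b) * v + r)%N * (r < s)%N%:R.

Let quarter b c :=
  \sum_(r < v) q ((4 * l + b) * v + r)%N * ((4 * l + b) * v + r < c)%N%:R.

Let primitiveE c : primitive_wave c =
  quarter 0 c - quarter 1 c - quarter 2 c + quarter 3 c.
Proof.
rewrite /primitive_wave (sum_wave _ (fun p => q p * (p < c)%N%:R))//.
rewrite !big_ord_recl big_ord0 /convex_pattern /= /quarter /fintype.bump /=.
by ring.
Qed.

Let quarter_lt b c : ((4 * l + b) * v + v <= c)%N -> (b < 4)%N -> quarter b c = v%:R.
Proof.
move=> bc b4; rewrite -(qbal (4 * l + b) _).1; last by lia.
apply: eq_bigr => r _; rewrite (_ : (_ < c)%N = true) ?mulr1//.
by have := ltn_ord r; lia.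
Qed.

Let quarter_gt b c : (c <= (4 * l + b) * v)%N -> quarter b c = 0.
Proof.
move=> bc; rewrite /quarter big1// => r _.
by rewrite (_ : (_ < c)%N = false) ?mulr0//; lia.
Qed.

Let quarter_in b s : (s < v)%N -> quarter b ((4 * l + b) * v + s) = Q b s.
Proof. by move=> sv; apply: eq_bigr => r _; rewrite ltn_add2l. Qed.

Let Q_bounds b s : (b < 4)%N -> 0 <= Q b s <= v%:R.
Proof.
move=> b4; apply/andP; split; first by apply: sumr_ge0 => r _; rewrite mulr_ge0.
rewrite -(qbal (4 * l + b) _).1; last by lia.
by apply: ler_sum => r _; rewrite ler_piMr// lern1 leq_b1.
Qed.

(** Before the interval nothing is summed yet; after it every quarter contributes its full mass [v],
    and the four signs cancel. *)
Lemma primitive_wave_out c : (c %/ (4 * v))%N != l -> primitive_wave c = 0.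
Proof.
move=> cl; rewrite primitiveE.
have v4 : (0 < 4 * v)%N by lia.
case: (ltngtP (c %/ (4 * v))%N l) cl => // [cl|lc] _.
  have {}cl : (c < 4 * l * v)%N by move: cl; rewrite ltn_divLR//; lia.
  by rewrite !quarter_gt; [ring|lia..].
have {}lc : (4 * l * v + 4 * v <= c)%N by move: lc; rewrite leq_divRL//; lia.
by rewrite !quarter_lt; [ring|lia..].
Qed.

Let primitive_in0 s : (s < v)%N -> primitive_wave ((4 * l + 0) * v + s) = Q 0 s.
Proof.
move=> sv; rewrite primitiveE quarter_in// !(quarter_gt _ ((4 * l + 0) * v + s)); [ring|lia..].
Qed.

Let primitive_in1 s : (s < v)%N -> primitive_wave ((4 * l + 1) * v + s) = v%:R - Q 1 s.
Proof.
move=> sv; rewrite primitiveE quarter_in// (quarter_lt 0); [|lia..].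
by rewrite !(quarter_gt _ ((4 * l + 1) * v + s)); [ring|lia..].
Qed.

Let primitive_in2 s : (s < v)%N -> primitive_wave ((4 * l + 2) * v + s) = - Q 2 s.
Proof.
move=> sv; rewrite primitiveE quarter_in// (quarter_lt 0); [|lia..].
rewrite (quarter_lt 1); [|lia..].
by rewrite !(quarter_gt _ ((4 * l + 2) * v + s)); [ring|lia..].
Qed.

Let primitive_in3 s : (s < v)%N -> primitive_wave ((4 * l + 3) * v + s) = Q 3 s - v%:R.
Proof.
move=> sv; rewrite primitiveE quarter_in// (quarter_lt 0); [|lia..].
rewrite (quarter_lt 1); [|lia..].
by rewrite (quarter_lt 2); [ring|lia..].
Qed.

(** On each quarter the primitive is, up to sign, a partial mass of that quarter or the complement
    of one to [v]. *)
Lemma primitive_wave_le c : `|primitive_wave c| <= (c %/ (4 * v) == l)%N%:R * v%:R.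
Proof.
case: (eqVneq (c %/ (4 * v))%N l) => [cl|cl]; last first.
  by rewrite primitive_wave_out// normr0 mul0r.
rewrite mul1r.
pose b := ((c %/ v) %% 4)%N; pose s := (c %% v)%N.
have sv : (s < v)%N by rewrite ltn_mod.
have cE : c = ((4 * l + b) * v + s)%N.
  by rewrite -cl (mulnC 4 v) divnMA (mulnC 4) /b /s -!divn_eq.
have b4 : (b < 4)%N by rewrite ltn_mod.
have Qb := Q_bounds b s b4; rewrite cE; move: Qb; rewrite ler_norml.
case: b b4 {cE} => [|[|[|[|//]]]] _; rewrite ?primitive_in0 ?primitive_in1
  ?primitive_in2 ?primitive_in3// => /andP[? ?]; apply/andP; split; lra.
Qed.

(** Exchanging the sums weights the point [r] by the number [v - 1 - r] of later positions, so [q]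
    enters only through the two moments fixed by [balanced]. *)
Let sumQ b : (b < 4)%N -> \sum_(s < v) Q b s = \sum_(r < v) (v%:R - 1 - r%:R).
Proof.
move=> b4; rewrite /Q exchange_big /=.
have cnt (r : 'I_v) : \sum_(s < v) (r < s)%N%:R = v%:R - 1 - r%:R :> R.
  rewrite -natr_sum (_ : \sum_(s < v) _ = v - r.+1)%N; last first.
    rewrite -(big_mkord xpredT (fun s => (r < s)%N : nat)).
    rewrite (big_cat_nat (n := r.+1))//= big_nat big1 => [|s /andP[_ sr]]; last first.
      by rewrite ltnNge -ltnS sr.
    rewrite add0n big_nat (eq_bigr (fun=> 1%N)) => [|s /andP[rs _]]; last by rewrite rs.
    by rewrite -big_nat sum_nat_const_nat muln1.
  by rewrite natrB// -natr1; ring.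
under eq_bigr do rewrite -mulr_sumr cnt mulrBr.
rewrite sumrB -mulr_suml.
have lb : (4 * l + b < 4 * M)%N by lia.
rewrite (qbal _ lb).1 (qbal _ lb).2 sumrB sumr_const card_ord.
by rewrite -[(v%:R - 1) *+ v]mulr_natr mulrC.
Qed.

(** The four sums of partial masses are equal and cancel; the constant [v] in the second and fourth
    quarters survives, on [v] points each. *)
Lemma haar_primitive_wave :
  \sum_(c < M * (4 * v)) wave haar_pattern v l c * primitive_wave c = 2 * v%:R ^+ 2.
Proof.
rewrite (sum_wave _ primitive_wave)// !big_ord_recl big_ord0 /haar_pattern /= /fintype.bump /=.
under eq_bigr do rewrite primitive_in0//.
under [X in _ + (_ * X + _)]eq_bigr do rewrite primitive_in1//.
under [X in _ + (_ + (_ * X + _))]eq_bigr do rewrite primitive_in2//.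
under [X in _ + (_ + (_ + (_ * X + _)))]eq_bigr do rewrite primitive_in3//.
rewrite !sumrB sumrN !sumQ// !sumr_const card_ord -[_ *+ v]mulr_natr.
ring.
Qed.

End Primitive.
End Blocks.

(** * Reduction to families of measures on a lattice *)

Lemma sum_tensor {R : comPzRingType} {I : finType} {N : nat} (F : I -> nat -> R) :
  \sum_(p : {ffun I -> 'I_N}) \prod_j F j (p j) = \prod_j \sum_(a < N) F j a.
Proof. by rewrite bigA_distr_bigA. Qed.

Section LatticeSum.
Context {R : realType} {d n : nat} {m : 'I_d -> nat} {x : 'I_n -> {ffun 'I_d -> R}}.
Hypotheses (m_gt0 : forall j, (0 < m j)%N) (x_design : lattice_design m x).

Lemma lattice_design_cube i : unit_cube (x i).
Proof.
have [_ xE] := x_design.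
have : range x (x i) by exists i.
rewrite xE => -[c cm ->] j; rewrite ffunE divr_ge0//=.
by rewrite ler_pdivrMr ?ltr0n// mul1r ler_nat ltnW.
Qed.

Lemma lattice_design_coord : {c : 'I_n -> {ffun 'I_d -> nat} |
  forall i, x i = [ffun j => (c i j)%:R / (m j)%:R]}.
Proof.
have [_ xE] := x_design.
have h i : {c : {ffun 'I_d -> nat} | x i = [ffun j => (c j)%:R / (m j)%:R]}.
  apply: cid; have : range x (x i) by exists i.
  rewrite xE => -[c _ ->]; exists [ffun j => c j].
  by apply/ffunP => j; rewrite !ffunE.
by exists (fun i => sval (h i)) => i; case: (h i).
Qed.

(** Replaces the design, with its enumeration and unequal side lengths, by a cube of side [N] that
    carries the support of [G]. *)
Lemma sum_lattice_design (c : 'I_n -> {ffun 'I_d -> nat}) (N : nat)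
    (G : {ffun 'I_d -> nat} -> R) :
  (forall i, x i = [ffun j => (c i j)%:R / (m j)%:R]) ->
  (forall j, (N <= m j)%N) ->
  (forall (u : {ffun 'I_d -> nat}) j, (N <= u j)%N -> G u = 0) ->
  \sum_(i < n) G (c i) =
  \sum_(p : {ffun 'I_d -> 'I_N}) G [ffun j => nat_of_ord (p j)].
Proof.
move=> cE Nm G0; have [x_inj xE] := x_design.
have pt (p : {ffun 'I_d -> 'I_N}) :
    {i : 'I_n | x i = [ffun j => (p j)%:R / (m j)%:R]}.
  apply: cid.
  have : @lattice R d m [ffun j => (p j)%:R / (m j)%:R].
    by exists (fun j => nat_of_ord (p j)) => // j; exact: leq_trans (ltn_ord _) (Nm j).
  by rewrite -xE => -[i _ <-]; exists i.
pose e p := sval (pt p).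
have mR j : (m j)%:R != 0 :> R by rewrite pnatr_eq0 -lt0n.
have ce p : c (e p) = [ffun j => nat_of_ord (p j)].
  apply/ffunP => j; have := svalP (pt p); rewrite -/(e p) cE => /ffunP/(_ j).
  rewrite !ffunE => /(mulIf (invr_neq0 (mR j)))/eqP.
  by rewrite eqr_nat => /eqP.
have e_inj : injective e.
  move=> p p' /(congr1 c); rewrite !ce => /ffunP h; apply/ffunP => j.
  by apply: val_inj; have := h j; rewrite !ffunE.
(* A design point outside the image of [e] has a coordinate of at least [N], where [G] vanishes. *)
rewrite (bigID (mem (codom e))) /= [X in _ + X]big1 ?addr0; last first.
  move=> i ie; have [/forallP h|/forallPn[j]] := boolP [forall j, (c i j < N)%N]; last first.
    by rewrite -leqNgt; exact: G0.
  case/negP: ie; apply/codomP; exists [ffun j => Ordinal (h j)].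
  apply: x_inj; rewrite !cE ce; apply/ffunP => j.
  by rewrite !ffunE.
rewrite -big_uniq /=; last by rewrite (map_inj_uniq e_inj) enum_uniq.
by rewrite big_map big_enum; apply: eq_bigr => p _; rewrite ce.
Qed.

End LatticeSum.

Lemma prod_natr_expn {R : comPzRingType} {d : nat} (b : nat) (k : 'I_d -> nat) :
  \prod_j (b ^ k j)%:R = (b ^ (\sum_j k j))%:R :> R.
Proof. by rewrite expn_sum natr_prod. Qed.

Section HaarFamily.
Context {R : realType} {d : nat} {Lev : finType}.
Variables (L K : nat) (k : Lev -> 'I_d -> nat).
Hypotheses (kL : forall t j, (k t j < L)%N) (kK : forall t, \sum_j k t j = K).
Hypothesis k_inj : forall t t', t != t' -> [exists j, k t j != k t' j].

Definition quarter_width (t : Lev) (j : 'I_d) : nat := 4 ^ (L - (k t j).+1).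
Local Notation v := quarter_width.

(* A grid [t] together with a cell of it; the pairs outside [cells] below are
   not used. *)
Definition wave_index : Type := Lev * {ffun 'I_d -> 'I_(4 ^ L)}.
HB.instance Definition _ := Finite.on wave_index.

Definition cells : {set wave_index} :=
  finset (fun r : wave_index => [forall j, r.2 j < 4 ^ k r.1 j]%N).

Lemma cellsP (r : wave_index) (j : 'I_d) : r \in cells -> (r.2 j < 4 ^ k r.1 j)%N.
Proof. by rewrite inE => /forallP. Qed.

Definition tensor_wave (pat : nat -> R) (r : wave_index) (p : 'I_d -> nat) : R :=
  \prod_j wave pat (v r.1 j) (r.2 j) (p j).

Lemma quarter_width_gt0 t j : (0 < v t j)%N.
Proof. by rewrite expn_gt0. Qed.

Lemma four_quarters t j : (4 * v t j = 4 ^ (L - k t j))%N.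
Proof. by rewrite -expnS; congr expn; have := kL t j; lia. Qed.

Lemma cells_width t j : (4 ^ k t j * (4 * v t j) = 4 ^ L)%N.
Proof. by rewrite four_quarters -expnD subnKC// ltnW. Qed.

Lemma sum_wave_orth (pat pat' : nat -> R) (t t' : Lev) (j : 'I_d) (l l' : nat) :
  mean_zero pat -> mean_zero pat' -> k t j != k t' j ->
  (l < 4 ^ k t j)%N -> (l' < 4 ^ k t' j)%N ->
  \sum_(p < 4 ^ L) wave pat (v t j) l p * wave pat' (v t' j) l' p = 0.
Proof.
wlog kk : t t' l l' pat pat' / (k t j < k t' j)%N.
  move=> hw pat0 pat'0 kne lt lt'.
  case: (ltngtP (k t j) (k t' j)) => kk; first exact: hw.
    under eq_bigr do rewrite mulrC.
    by apply: hw => //; rewrite eq_sym.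
  by rewrite kk eqxx in kne.
move=> pat0 pat'0 _ lt lt'; rewrite -(cells_width t j).
apply: (@wave_orth_fine _ pat pat' (v t j) (v t' j) l l' (4 ^ k t j) (4 ^ k t' j)) => //.
- by rewrite !cells_width.
- rewrite four_quarters; apply: dvdn_exp2l; lia.
- exact: quarter_width_gt0.
Qed.

(** One vanishing axis suffices: for different grids, one where the levels differ; for the same
    grid, one where the supports are disjoint. *)
Lemma tensor_wave_orth (pat pat' : nat -> R) (r r' : wave_index) :
  mean_zero pat -> mean_zero pat' -> r \in cells -> r' \in cells -> r != r' ->
  \sum_(p : {ffun 'I_d -> 'I_(4 ^ L)})
    tensor_wave pat r (fun j => p j) * tensor_wave pat' r' (fun j => p j) = 0.
Proof.
move=> pat0 pat'0 rS r'S rr'; rewrite /tensor_wave.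
under eq_bigr do rewrite -big_split /=.
rewrite (sum_tensor (fun j a => wave pat (v r.1 j) (r.2 j) a *
  wave pat' (v r'.1 j) (r'.2 j) a)).
have [tt'|/k_inj/existsP[j kj]] := eqVneq r.1 r'.1; last first.
  rewrite (bigD1 j)//= sum_wave_orth ?mul0r//; exact: cellsP.
have [j lj] : exists j, r.2 j != r'.2 j.
  apply/existsP; apply: contraNT rr' => /existsPn h.
  case: r r' tt' h {rS r'S} => [t l] [t' l'] /= -> h; apply/eqP; congr pair.
  by apply/ffunP => j; apply/eqP; have := h j; rewrite negbK.
rewrite (bigD1 j)//= big1 ?mul0r// => a _; rewrite tt'.
exact: wave_orth_same.
Qed.

Hypothesis KdL : (K <= d * L)%N.
(** The number of lattice points in a cell, common to all grids because their levels sum to [K]. *)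
Definition cell_size : R := (4 ^ (d * L - K))%:R.

Lemma prod_four_quarters t : \prod_j ((4 * v t j)%:R : R) = cell_size.
Proof.
under eq_bigr do rewrite four_quarters.
rewrite prod_natr_expn /cell_size; congr (4 ^ _)%:R.
have : (\sum_j (L - k t j) + \sum_j k t j = d * L)%N.
  rewrite -big_split /= (eq_bigr (fun=> L)); last by move=> j _; rewrite subnK// ltnW.
  by rewrite sum_nat_const card_ord.
by rewrite kK; lia.
Qed.

Lemma tensor_wave_norm (pat : nat -> R) (r : wave_index) :
  (forall b, pat b ^+ 2 = 1) -> r \in cells ->
  \sum_(p : {ffun 'I_d -> 'I_(4 ^ L)}) tensor_wave pat r (fun j => p j) ^+ 2 = cell_size.
Proof.
move=> pat1 rS; rewrite /tensor_wave.
under eq_bigr do rewrite -prodrXl.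
rewrite (sum_tensor (fun j a => wave pat (v r.1 j) (r.2 j) a ^+ 2)).
rewrite -(prod_four_quarters r.1); apply: eq_bigr => j _.
by rewrite -(sum_wave_sqr pat _ _ _ pat1 (cellsP r j rS)) cells_width.
Qed.

Lemma card_cells : #|cells|%:R = #|Lev|%:R * (4 ^ K)%:R :> R.
Proof.
have cnt (c : nat) : (c <= 4 ^ L)%N -> \sum_(a < 4 ^ L) (a < c)%N%:R = c%:R :> R.
  move=> cL; rewrite -natr_sum; congr (_%:R).
  rewrite -[RHS](card_ord c) -sum1_card (big_ord_widen (4 ^ L) (fun=> 1%N) cL).
  by rewrite [RHS]big_mkcond; apply: eq_bigr => a _; case: (_ < _)%N.
rewrite -sum1_card natr_sum big_mkcond /=.
rewrite (eq_bigr (fun r : wave_index => \prod_j (r.2 j < 4 ^ k r.1 j)%N%:R)); last first.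
  by move=> r _; rewrite inE -natr_forall; case: [forall _, _].
rewrite -(pair_big xpredT xpredT (fun t (l : {ffun 'I_d -> 'I_(4 ^ L)}) =>
  \prod_j (l j < 4 ^ k t j)%N%:R)) /=.
under eq_bigr => t _.
  rewrite (sum_tensor (fun j a => (a < 4 ^ k t j)%N%:R)).
  under eq_bigr do rewrite cnt ?leq_exp2l ?(ltnW (kL _ _))//.
  rewrite prod_natr_expn kK.
  over.
by rewrite sumr_const mulr_natl.
Qed.

Section Core.
Variables (n : nat) (m : 'I_d -> nat) (x : 'I_n -> {ffun 'I_d -> R}).
Hypotheses (m_gt0 : forall j, (0 < m j)%N) (x_design : lattice_design m x).
Hypotheses (Lm : forall j, (4 ^ L <= m j)%N) (n_gt0 : (0 < n)%N).
Variables (disp : measure_display) (T : measurableType disp).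
Variables (P : probability T R) (xi : 'I_n -> {RV P >-> R}) (sigma : R).
Hypotheses (sigma_neq0 : sigma != 0) (xi_iid : iid_normal sigma xi).
Variables (V a : R) (mu : {ffun wave_index -> bool} -> {ffun 'I_d -> 'I_(4 ^ L)} -> R).
Hypothesis mu_mass : forall e, \sum_p `|mu e p| <= V.
Hypothesis mu_flip : forall e (r : wave_index), r \in cells ->
  exists q : 'I_d -> nat -> R,
    [/\ forall j p, 0 <= q j p,
        forall j, balanced (v r.1 j) (4 * 4 ^ k r.1 j) (q j) &
        forall p : {ffun 'I_d -> 'I_(4 ^ L)},
          mu (setbit e r true) p - mu (setbit e r false) p =
          2 * a * \prod_j (wave convex_pattern (v r.1 j) (r.2 j) (p j) * q j (p j))].
Hypothesis bit_undetectable :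
  4 * a ^+ 2 * cell_size ^+ 3 / 16 ^+ d <= sigma ^+ 2 / 2.

(** Raising the index by one keeps every coordinate positive, as [HK0_variation_step] requires, and
    turns [<=] on the design into the [<] of [primitive_wave]. *)
Let atom (p : {ffun 'I_d -> 'I_(4 ^ L)}) : {ffun 'I_d -> R} :=
  [ffun j => (p j).+1%:R / (m j)%:R].
Let f e (u : {ffun 'I_d -> R}) := \sum_p mu e p * (orthant (atom p) u)%:R.

Let f_HK e : (HK0_variation (f e) <= V%:E)%E.
Proof.
apply: le_trans (HK0_variation_step R d _ (mu e) atom _) _.
  by move=> p j; rewrite ffunE divr_gt0 ?ltr0n.
by rewrite lee_fin.
Qed.

Let c := sval (lattice_design_coord x_design).
Let cE : forall i, x i = [ffun j => (c i j)%:R / (m j)%:R].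
Proof. exact: (svalP (lattice_design_coord x_design)). Qed.

Let orthant_design p i : orthant (atom p) (x i) = [forall j, p j < c i j]%N.
Proof.
apply: eq_forallb => j; rewrite cE !ffunE ler_pM2r ?invr_gt0 ?ltr0n//.
by rewrite ler_nat.
Qed.

Let prim (r : wave_index) (q : 'I_d -> nat -> R) j :=
  primitive_wave (v r.1 j) (4 ^ k r.1 j) (r.2 j) (q j).

Let flip_design e (r : wave_index) : r \in cells ->
  exists q : 'I_d -> nat -> R,
    [/\ forall j p, 0 <= q j p,
        forall j, balanced (v r.1 j) (4 * 4 ^ k r.1 j) (q j) &
        forall i, f (setbit e r true) (x i) - f (setbit e r false) (x i) =
          2 * a * \prod_j prim r q j (c i j)].
Proof.
move=> rS; have [q [q0 qbal muE]] := mu_flip e r rS; exists q; split => // i.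
rewrite /f -sumrB.
transitivity (\sum_(p : {ffun 'I_d -> 'I_(4 ^ L)}) 2 * a *
    \prod_j (wave convex_pattern (v r.1 j) (r.2 j) (p j) *
      (q j (p j) * (p j < c i j)%N%:R))).
  apply: eq_bigr => p _; rewrite -mulrBl muE orthant_design natr_forall -[LHS]mulrA.
  by rewrite -big_split /=; congr (_ * _); apply: eq_bigr => j _; rewrite mulrA.
rewrite -mulr_sumr (sum_tensor (fun j b => wave convex_pattern (v r.1 j) (r.2 j) b *
      (q j b * (b < c i j)%N%:R))); congr (_ * _).
apply: eq_bigr => j _; rewrite /prim /primitive_wave.
by move: (r.2 j : nat) => l; rewrite cells_width.
Qed.

(** Assouad's lemma with Haar tensors as test vectors: the pairing and the squared size of a flip
    factor over the axes into one-dimensional sums. *)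
Lemma core_lower_bound :
  ((#|Lev|%:R * (4 ^ K)%:R * (a ^+ 2 * cell_size ^+ 3) / (2 * 64 ^+ d * n%:R))%:E
    <= minimax_risk x xi V)%E.
Proof.
have w0 : 0 < cell_size by rewrite ltr0n expn_gt0.
have prim_out (r : wave_index) q j b : r \in cells ->
    (forall j p, 0 <= q j p) ->
    (forall j, balanced (v r.1 j) (4 * 4 ^ k r.1 j) (q j)) ->
    (4 ^ L <= b)%N -> prim r q j b = 0.
  move=> rS q0 qbal Lb; apply: primitive_wave_out => //.
  - exact: quarter_width_gt0.
  - exact: cellsP.
  - have := cellsP r j rS; apply: contraTneq => <-.
    by rewrite -leqNgt leq_divRL ?muln_gt0 ?quarter_width_gt0// cells_width.
pose psi (r : wave_index) i := tensor_wave haar_pattern r (c i).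
have psi_out (r : wave_index) (u : {ffun 'I_d -> nat}) j :
    r \in cells -> (4 ^ L <= u j)%N -> tensor_wave haar_pattern r u = 0.
  move=> rS Lu; rewrite /tensor_wave (bigD1 j)//= /wave.
  case: eqP; last by rewrite !mul0r.
  move=> uE; have := cellsP r j rS; rewrite -uE ltn_divLR ?muln_gt0 ?quarter_width_gt0//.
  by rewrite cells_width ltnNge Lu.
have sumc := @sum_lattice_design R d n m x m_gt0 x_design c (4 ^ L) _ cE Lm.
have tensor_ffun pat r (p : {ffun 'I_d -> 'I_(4 ^ L)}) :
    tensor_wave pat r [ffun j => nat_of_ord (p j)] = tensor_wave pat r (fun j => p j).
  by apply: eq_bigr => j _; rewrite ffunE.
(* On each axis the Haar pairing is [2 * v ^+ 2], which is [(4 * v) ^+ 2 / 8]. *)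
pose Theta := 2 * a * (cell_size ^+ 2 / 8 ^+ d).
have := @assouad R disp T P d n xi sigma sigma_neq0 xi_iid x wave_index cells f psi
  cell_size Theta V n_gt0 (lattice_design_cube m_gt0 x_design) w0 _ _ f_HK _ _.
have -> : #|cells|%:R * Theta ^+ 2 / (8 * cell_size * n%:R) =
   #|Lev|%:R * (4 ^ K)%:R * (a ^+ 2 * cell_size ^+ 3) / (2 * 64 ^+ d * n%:R).
  rewrite card_cells /Theta (_ : 64 = 8 * 8); last by rewrite -natrM.
  rewrite [in RHS]exprMn.
  have e0 : 8 ^+ d != 0 :> R by rewrite expf_neq0.
  have w_neq0 : cell_size != 0 by rewrite gt_eqF.
  have n_neq0 : n%:R != 0 :> R by rewrite pnatr_eq0 -lt0n.
  move: e0 w_neq0 n_neq0; move: (8 ^+ d : R) cell_size (n%:R : R) (#|Lev|%:R : R) ((4 ^ K)%:R : R).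
  move=> e w n' l4 k4 e0 w_neq0 n_neq0; field.
  by rewrite e0 w_neq0 n_neq0.
apply.
- move=> r rS; rewrite /psi (sumc (fun u => tensor_wave haar_pattern r u ^+ 2)).
    under eq_bigr do rewrite tensor_ffun.
    by apply: tensor_wave_norm => //; exact: haar_pattern_sqr.
  by move=> u j uj; rewrite (psi_out _ _ j)// expr0n.
- move=> r r' rS r'S rr'; rewrite /psi.
  rewrite (sumc (fun u => tensor_wave haar_pattern r u * tensor_wave haar_pattern r' u)).
    under eq_bigr do rewrite !tensor_ffun.
    by apply: tensor_wave_orth => //; exact: haar_pattern_mean.
  by move=> u j uj; rewrite (psi_out _ _ j)// mul0r.
- move=> e r rS; have [q [q0 qbal dE]] := flip_design e r rS.
  under eq_bigr do rewrite dE.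
  rewrite (sumc (fun u => (2 * a * \prod_j prim r q j (u j)) ^+ 2)); last first.
    by move=> u j uj; rewrite (bigD1 j)//= prim_out// mul0r mulr0 expr0n.
  apply: le_trans bit_undetectable.
  under eq_bigr => p _.
    under eq_bigr do rewrite ffunE.
    rewrite exprMn -prodrXl; over.
  rewrite -mulr_sumr (sum_tensor (fun j b => prim r q j b ^+ 2)).
  have -> : 4 * a ^+ 2 * cell_size ^+ 3 / 16 ^+ d =
      (2 * a) ^+ 2 * (cell_size ^+ 3 / 16 ^+ d) by ring.
  rewrite ler_wpM2l ?sqr_ge0// -(prod_four_quarters r.1) -prodrXl.
  rewrite -[X in _ ^+ X](card_ord d) -prodr_const -prodf_div.
  apply: ler_prod => j _; apply/andP; split.
    by apply: sumr_ge0 => b _; exact: sqr_ge0.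
  (* The wave with constant pattern 1 is the indicator of the interval. The primitive is at most [v]
     there, so its squares sum to at most [v ^+ 2 * (4 * v)], a sixteenth of [(4 * v) ^+ 3]. *)
  have := sum_wave_sqr (fun=> 1 : R) (v r.1 j) _ _ (fun=> expr1n _ _) (cellsP r j rS).
  rewrite cells_width => sum1.
  have -> : (4 * v r.1 j)%:R ^+ 3 / 16 = (v r.1 j)%:R ^+ 2 * (4 * v r.1 j)%:R :> R.
    by rewrite natrM; field.
  rewrite -sum1 mulr_sumr; apply: ler_sum => b _.
  rewrite -real_normK ?num_real// -exprMn ler_sqr ?nnegrE//; last first.
    by rewrite /wave mulr1 mulr_ge0.
  rewrite /wave mulr1 mulrC.
  by apply: primitive_wave_le => //; [exact: quarter_width_gt0|exact: cellsP].
- move=> e r rS; have [q [q0 qbal dE]] := flip_design e r rS.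
  under eq_bigr do rewrite dE.
  rewrite (sumc (fun u =>
    tensor_wave haar_pattern r u * (2 * a * \prod_j prim r q j (u j)))); last first.
    by move=> u j uj; rewrite (psi_out _ _ j)// mul0r.
  under eq_bigr => p _.
    rewrite tensor_ffun mulrCA -big_split /=.
    under eq_bigr do rewrite ffunE.
    over.
  rewrite -mulr_sumr (sum_tensor (fun j b => wave haar_pattern (v r.1 j) (r.2 j) b * prim r q j b)).
  rewrite /Theta; congr (_ * _); rewrite -(prod_four_quarters r.1) -prodrXl.
  rewrite -[X in _ = _ / _ ^+ X](card_ord d) -prodr_const -prodf_div.
  apply: eq_bigr => j _.
  have := haar_primitive_wave (v r.1 j) (4 ^ k r.1 j) (r.2 j) (q j)
    (quarter_width_gt0 _ _) (cellsP r j rS) (qbal j).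
  rewrite cells_width => ->.
  by rewrite natrM; field.
Qed.

End Core.
End HaarFamily.

(** * Signed sums of waves *)

Lemma sum_norm_le {R : realFieldType} (I : finType) (u : I -> R) (V : R) : 0 < V ->
  #|I|%:R * \sum_i u i ^+ 2 <= V ^+ 2 -> \sum_i `|u i| <= V.
Proof.
move=> V0 uV; have [I0|I0] := posnP #|I|.
  by rewrite big1 ?ltW// => i; have := fintype0 i; rewrite I0.
have cI : 0 < #|I|%:R :> R by rewrite ltr0n.
(* AM-GM, with the weight that is optimal when all [|u i|] are equal *)
have amgm i : `|u i| <= (V / #|I|%:R + u i ^+ 2 * (#|I|%:R / V)) / 2.
  have -> : u i ^+ 2 = `|u i| ^+ 2 by rewrite real_normK ?num_real.
  rewrite -subr_ge0.
  have -> : (V / #|I|%:R + `|u i| ^+ 2 * (#|I|%:R / V)) / 2 - `|u i| =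
      (`|u i| * #|I|%:R - V) ^+ 2 / (2 * V * #|I|%:R).
    by field; rewrite !gt_eqF.
  by rewrite divr_ge0 ?sqr_ge0// !mulr_ge0// ltW.
apply: le_trans (ler_sum _ (fun i _ => amgm i)) _.
rewrite -mulr_suml big_split /= sumr_const -mulr_suml -[_ *+ _]mulr_natr divfK ?gt_eqF//.
rewrite ler_pdivrMr// mulr_natr mulr2n lerD2l mulrA ler_pdivrMr// -expr2.
by rewrite mulrC.
Qed.

Lemma expr64 {R : pzSemiRingType} (K : nat) : 64 ^+ K = (4 ^ K)%:R ^+ 3 :> R.
Proof.
rewrite (_ : 64 = 4 ^+ 3); last by rewrite -natrX.
by rewrite natrX -!exprM mulnC.
Qed.

Section SignedSum.
Context {R : realType} {d : nat} {Lev : finType}.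
Variables (L K : nat) (k : Lev -> 'I_d -> nat).
Hypotheses (kL : forall t j, (k t j < L)%N) (kK : forall t, \sum_j k t j = K).
Hypothesis k_inj : forall t t', t != t' -> [exists j, k t j != k t' j].
Hypotheses (KdL : (K <= d * L)%N) (Lev_gt0 : (0 < #|Lev|)%N).
Variables (n : nat) (m : 'I_d -> nat) (x : 'I_n -> {ffun 'I_d -> R}).
Hypotheses (m_gt0 : forall j, (0 < m j)%N) (x_design : lattice_design m x).
Hypotheses (Lm : forall j, (4 ^ L <= m j)%N) (n_gt0 : (0 < n)%N).
Variables (disp : measure_display) (T : measurableType disp).
Variables (P : probability T R) (xi : 'I_n -> {RV P >-> R}) (sigma V : R).
Hypotheses (sigma_neq0 : sigma != 0) (xi_iid : iid_normal sigma xi) (V_gt0 : 0 < V).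

Local Notation index := (wave_index (d := d) (Lev := Lev) L).

Definition sign (b : bool) : R := if b then 1 else -1.

(** Cross terms vanish by orthogonality, and each of the [#|Lev| * 4 ^ K] waves contributes
    [cell_size]. *)
Lemma sum_waves_sqr (e : {ffun index -> bool}) :
  \sum_(p : {ffun 'I_d -> 'I_(4 ^ L)})
    (\sum_(r in cells L k) sign (e r) * tensor_wave L k convex_pattern r (fun j => p j)) ^+ 2 =
  #|Lev|%:R * (4 ^ (d * L))%:R.
Proof.
pose F r (p : {ffun 'I_d -> 'I_(4 ^ L)}) := tensor_wave L k (@convex_pattern R) r (fun j => p j).
transitivity (\sum_(p : {ffun 'I_d -> 'I_(4 ^ L)}) \sum_(r in cells L k) \sum_(r' in cells L k)
    sign (e r) * sign (e r') * (F r p * F r' p)).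
  apply: eq_bigr => p _; rewrite expr2 mulr_suml; apply: eq_bigr => r _.
  by rewrite mulr_sumr; apply: eq_bigr => r' _; rewrite /F; ring.
rewrite exchange_big; transitivity (\sum_(r in cells L k) @cell_size R d L K).
  apply: eq_bigr => r rS; rewrite exchange_big (bigD1 r)//= [X in _ + X]big1 ?addr0.
    under eq_bigr do rewrite -expr2 -expr2.
    rewrite -mulr_sumr (tensor_wave_norm L K k kL kK KdL)//; last exact: convex_pattern_sqr.
    by rewrite /sign; case: (e r); rewrite ?sqrrN expr1n mul1r.
  move=> r' /andP[r'S r'r]; rewrite -mulr_sumr (tensor_wave_orth L k kL k_inj) ?mulr0//.
  - exact: convex_pattern_mean.
  - exact: convex_pattern_mean.
  - by rewrite eq_sym.
rewrite sumr_const -[LHS]mulr_natl (card_cells L K k kL kK) -mulrA; congr (_ * _).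
by rewrite /cell_size -natrM -expnD subnKC.
Qed.

(** [E] is [a ^+ 2 * cell_size ^+ 3] for the largest amplitude [a] that the L2 bound on the mass
    permits. *)
Lemma signed_sum_lower_bound :
  let E := V ^+ 2 * (4 ^ (d * L))%:R / (64 ^+ K * #|Lev|%:R) in
  4 * E / 16 ^+ d <= sigma ^+ 2 / 2 ->
  ((#|Lev|%:R * (4 ^ K)%:R * E / (2 * 64 ^+ d * n%:R))%:E
    <= minimax_risk x xi V)%E.
Proof.
move=> E small; pose N : R := (4 ^ (d * L))%:R.
have N0 : 0 < N by rewrite ltr0n expn_gt0.
have l0 : 0 < #|Lev|%:R :> R by rewrite ltr0n.
(* Cauchy-Schwarz over the [N] lattice points bounds the mass by [a * N * sqrt #|Lev|]. *)
pose a := V / (N * Num.sqrt #|Lev|%:R).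
have a2 : a ^+ 2 = V ^+ 2 / (N ^+ 2 * #|Lev|%:R).
  by rewrite /a exprMn exprVn exprMn sqr_sqrtr// ltW.
have aE : a ^+ 2 * @cell_size R d L K ^+ 3 = E.
  have wN : @cell_size R d L K * (4 ^ K)%:R = N.
    by rewrite /cell_size -natrM -expnD subnK.
  rewrite a2 /E -/N -wN expr64.
  have w0 : @cell_size R d L K != 0 by rewrite gt_eqF// ltr0n expn_gt0.
  have k0 : (4 ^ K)%:R != 0 :> R by rewrite pnatr_eq0 -lt0n expn_gt0.
  move: w0 k0; move: (@cell_size R d L K) ((4 ^ K)%:R : R) => w k4 w0 k0.
  by field; rewrite w0 k0 gt_eqF.
pose mu (e : {ffun index -> bool}) (p : {ffun 'I_d -> 'I_(4 ^ L)}) :=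
  a * \sum_(r in cells L k) sign (e r) * tensor_wave L k convex_pattern r (fun j => p j).
rewrite -aE; apply: (core_lower_bound L K k kL kK k_inj KdL n m x m_gt0 x_design Lm n_gt0
  disp T P xi sigma sigma_neq0 xi_iid V a mu).
- move=> e; apply: sum_norm_le => //.
  under eq_bigr do rewrite exprMn.
  rewrite -mulr_sumr sum_waves_sqr card_ffun !card_ord -expnM mulnC a2 -/N.
  rewrite le_eqVlt; apply/orP; left; apply/eqP.
  by field; rewrite !gt_eqF.
(* A flip changes a single sign, hence a single wave, by [2 * a] and without extra weight. *)
- move=> e r rS; exists (fun _ _ => 1); split => // [j|p]; first exact: balanced1.
  rewrite /mu -mulrBr -sumrB (bigD1 r)//= big1 ?addr0; last first.
    by move=> r' /andP[_ /negPf r'r]; rewrite !ffunE r'r subrr.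
  rewrite !ffunE eqxx /sign -mulrBl opprK mulrA (mulrC a); congr (_ * _).
  by apply: eq_bigr => j _; rewrite mulr1.
- by rewrite -(mulrA 4) aE.
Qed.

End SignedSum.

(** * Riesz products in dimension two *)

Section RieszFactors.
Context {R : realType}.
Variables (L : nat) (E : nat -> nat -> R).

(** A one-dimensional Riesz factor at level [k]; its coefficient may vary with the interval but not
    inside it, which is what preserves balance. *)
Definition riesz_factor (k t p : nat) : R :=
  1 + E t (p %/ 4 ^ (L - k))%N * convex_pattern ((p %/ 4 ^ (L - k.+1)) %% 4)%N.

Lemma balanced_riesz_factor (k t : nat) (q : nat -> R) : (k < L)%N ->
  balanced (4 ^ (L - k.+1)) (4 ^ k.+1) q ->
  balanced (4 ^ (L - k)) (4 ^ k) (fun p => riesz_factor k t p * q p).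
Proof.
move=> kL; rewrite expnS => /(balanced_riesz _ _ _ (E t)).
by rewrite -expnS (_ : (L - k.+1).+1 = L - k)%N //; lia.
Qed.

(** Factors must be multiplied in from the finest level to the coarsest. Here the level grows with
    [t], so the induction starts from [m = M] and lowers [m]. *)
Lemma balanced_riesz_up (k M m : nat) : (m <= M)%N -> (k + M <= L)%N ->
  balanced (4 ^ (L - (k + m))) (4 ^ (k + m))
    (fun p => \prod_(m <= t < M) riesz_factor (k + t) t p).
Proof.
move=> mM kM; rewrite -(subKn mM); move: (M - m)%N (leq_subr m M) => j.
elim: j => [_|j IHj jM].
  rewrite subn0 (_ : (fun _ => _) = fun=> 1); first exact: balanced1.
  by apply/funext => p; rewrite big_geq.
have -> : (fun p => \prod_(M - j.+1 <= t < M) riesz_factor (k + t) t p) =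
    (fun p => riesz_factor (k + (M - j.+1)) (M - j.+1) p *
              \prod_(M - j <= t < M) riesz_factor (k + t) t p).
  apply/funext => p; rewrite big_ltn; last by lia.
  by rewrite (_ : (M - j.+1).+1 = M - j)%N//; lia.
apply: balanced_riesz_factor; first by lia.
have -> : ((k + (M - j.+1)).+1 = k + (M - j))%N by lia.
by apply: IHj; lia.
Qed.

(** Here the level falls as [t] grows, so the last factor is the coarsest and the induction raises
    [m]. *)
Lemma balanced_riesz_down (k m : nat) : (m <= k.+1)%N -> (k < L)%N ->
  balanced (4 ^ (L - (k.+1 - m))) (4 ^ (k.+1 - m))
    (fun p => \prod_(0 <= t < m) riesz_factor (k - t) t p).
Proof.
move=> mk kL; elim: m mk => [_|m IHm mk].
  rewrite subn0 (_ : (fun _ => _) = fun=> 1); first exact: balanced1.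
  by apply/funext => p; rewrite big_geq.
have -> : (fun p => \prod_(0 <= t < m.+1) riesz_factor (k - t) t p) =
    (fun p => riesz_factor (k - m) m p * \prod_(0 <= t < m) riesz_factor (k - t) t p).
  by apply/funext => p; rewrite big_nat_recr//= mulrC.
rewrite subSS; apply: balanced_riesz_factor; first by lia.
have -> : ((k - m).+1 = k.+1 - m)%N by lia.
by apply: IHm; lia.
Qed.

Lemma riesz_factor_ge0 (k t p : nat) : (forall x, `|E t x| <= 1) ->
  0 <= riesz_factor k t p.
Proof.
move=> E1; rewrite /riesz_factor; set b := (_ %% 4)%N; set c := (p %/ _)%N.
have : `|E t c * convex_pattern b| <= 1.
  by rewrite normrM /convex_pattern; case: ifP; rewrite ?normrN normr1 mulr1.
by rewrite ler_norml => /andP[? _]; lra.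
Qed.

End RieszFactors.

Lemma sum_ffun2 {R : nmodType} {S : finType} (G : {ffun 'I_2 -> S} -> R) :
  \sum_p G p = \sum_a \sum_b G [ffun j : 'I_2 => if j == ord0 then a else b].
Proof.
rewrite pair_big /=.
rewrite (reindex (fun ab : S * S => [ffun j : 'I_2 => if j == ord0 then ab.1 else ab.2])) //=.
exists (fun p : {ffun 'I_2 -> S} => (p ord0, p ord_max)) => [[a b] _|p _] /=.
  by rewrite !ffunE.
apply/ffunP => j; rewrite ffunE.
by case: j => [[|[|//]] j2]; congr (p _); apply: val_inj.
Qed.

Lemma div_expn_coarse (x y p p' : nat) : (x <= y)%N ->
  (p %/ 4 ^ x = p' %/ 4 ^ x)%N -> (p %/ 4 ^ y = p' %/ 4 ^ y)%N.
Proof. by move=> xy h; rewrite -(subnKC xy) expnD !divnMA h. Qed.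

Section RieszProduct.
Context {R : realType}.
Variables (L M : nat).
Hypothesis ML : (2 * M < L)%N.

(** As [t] grows the grid gets finer in the first coordinate and coarser in the second, at constant
    sum; all levels stay between [M] and [2 * M]. *)
Definition riesz_level (t : 'I_M.+1) (j : 'I_2) : nat :=
  if j == ord0 then (M + t)%N else (2 * M - t)%N.

Lemma riesz_level_lt t j : (riesz_level t j < L)%N.
Proof. by rewrite /riesz_level; have := ltn_ord t; case: ifP => _; lia. Qed.

Lemma sum_riesz_level t : (\sum_j riesz_level t j = 3 * M)%N.
Proof.
by rewrite big_ord_recl big_ord1 /riesz_level /=; have := ltn_ord t; clear; lia.
Qed.

Lemma riesz_level_inj t t' : t != t' -> [exists j, riesz_level t j != riesz_level t' j].
Proof.
move=> tt'; apply/existsP; exists ord0; rewrite /riesz_level eqxx eqn_add2l.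
exact: tt'.
Qed.

Local Notation index := (wave_index (d := 2) (Lev := 'I_M.+1) L).

Let o0 : 'I_(4 ^ L) := Ordinal (expn_gt0 4 L : (0 < 4 ^ L)%N).

(** The default [o0] is not reached for indices below [4 ^ L], the range in [cell_at_eq]. *)
Definition cell_at (x y : nat) : {ffun 'I_2 -> 'I_(4 ^ L)} :=
  [ffun j => insubd o0 (if j == ord0 then x else y)].

Lemma cell_at_eq (x y : nat) (l : {ffun 'I_2 -> 'I_(4 ^ L)}) :
  (x < 4 ^ L)%N -> (y < 4 ^ L)%N ->
  (cell_at x y == l) = (x == l ord0)%N && (y == l ord_max)%N.
Proof.
move=> xL yL; apply/eqP/andP => [<-|[/eqP -> /eqP ->]].
  by rewrite !ffunE /= !val_insubd xL yL.
apply/ffunP => j; rewrite ffunE; apply: val_inj; rewrite val_insubd.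
by case: j => [[|[|//]] j2] /=; rewrite ltn_ord; congr (nat_of_ord (l _)); apply: val_inj.
Qed.

Variable e : {ffun index -> bool}.

(** With [y] frozen, the two-dimensional factor of grid [t] becomes a [riesz_factor] in [x] with
    this coefficient; [col_coef] freezes [x] instead. *)
Definition row_coef (y t x : nat) : R :=
  sign (e (inord t, cell_at x (y %/ 4 ^ (L - (2 * M - t))))) *
  convex_pattern ((y %/ 4 ^ (L - (2 * M - t).+1)) %% 4)%N.

Definition col_coef (x t y : nat) : R :=
  sign (e (inord t, cell_at (x %/ 4 ^ (L - (M + t))) y)) *
  convex_pattern ((x %/ 4 ^ (L - (M + t).+1)) %% 4)%N.

Definition riesz_term (t x y : nat) : R := riesz_factor L (row_coef y) (M + t) t x.

Lemma riesz_term_col t x y :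
  riesz_term t x y = riesz_factor L (col_coef x) (2 * M - t) t y.
Proof. by rewrite /riesz_term /riesz_factor /row_coef /col_coef mulrAC. Qed.

Lemma sign_pattern_le1 (b : bool) (c : nat) :
  `|sign b * convex_pattern c : R| <= 1.
Proof.
by rewrite normrM /sign /convex_pattern; case: b; case: ifP;
  rewrite ?normrN !normr1 mulr1.
Qed.

Lemma riesz_term_ge0 t x y : 0 <= riesz_term t x y.
Proof. by apply: riesz_factor_ge0 => z; exact: sign_pattern_le1. Qed.

Definition riesz_product (x y : nat) : R := \prod_(0 <= t < M.+1) riesz_term t x y.

(** In each row the levels [M], ..., [2 * M] occur once each, so the product is balanced on
    intervals of level [M] and has the mass of the constant 1. *)
Lemma sum_riesz_product :
  \sum_(x < 4 ^ L) \sum_(y < 4 ^ L) riesz_product x y = (4 ^ L)%:R ^+ 2.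
Proof.
rewrite exchange_big /=.
have row y : \sum_(x < 4 ^ L) riesz_product x y = (4 ^ L)%:R.
  have := @balanced_riesz_up R L (row_coef y) M M.+1 0 (leq0n _).
  rewrite addn0 => bal; have {}bal := bal ltac:(lia).
  have LE : (4 ^ L = 4 ^ M * 4 ^ (L - M))%N by rewrite -expnD subnKC//; lia.
  rewrite LE (sum_blocks (fun x => riesz_product x y)).
  under eq_bigr => a _ do rewrite (bal a (ltn_ord a)).1.
  by rewrite sumr_const card_ord -[LHS]mulr_natl -natrM.
by under eq_bigr do rewrite row; rewrite sumr_const card_ord -[LHS]mulr_natl expr2.
Qed.

End RieszProduct.

Section RieszFlip.
Context {R : realType}.
Variables (L M : nat).
Hypothesis ML : (2 * M < L)%N.
Local Notation index := (wave_index (d := 2) (Lev := 'I_M.+1) L).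
Local Notation level := (@riesz_level M).
Variables (e : {ffun index -> bool}) (t0 : 'I_M.+1) (l : {ffun 'I_2 -> 'I_(4 ^ L)}).

Lemma riesz_term_setbit (b : bool) (t x y : nat) : (t < M.+1)%N -> t != t0 ->
  riesz_term L M (setbit e (t0, l) b) t x y = riesz_term L M e t x y :> R.
Proof.
move=> tM tt0; rewrite /riesz_term /riesz_factor /row_coef ffunE.
case: eqP => // -[] /(congr1 val) /=; rewrite inordK// => tE.
by rewrite tE eqxx in tt0.
Qed.

Lemma riesz_term_flip (x y : nat) : (x < 4 ^ L)%N -> (y < 4 ^ L)%N ->
  riesz_term L M (setbit e (t0, l) true) t0 x y -
  riesz_term L M (setbit e (t0, l) false) t0 x y =
  2 * (wave convex_pattern (quarter_width L level t0 ord0) (l ord0) x *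
       wave convex_pattern (quarter_width L level t0 ord_max) (l ord_max) y) :> R.
Proof.
move=> xL yL; rewrite /riesz_term /riesz_factor /row_coef /wave.
rewrite !(four_quarters L level (riesz_level_lt L M ML)) /quarter_width.
have -> : riesz_level M t0 ord0 = (M + t0)%N by [].
have -> : riesz_level M t0 ord_max = (2 * M - t0)%N by [].
have lt_div p w : (p < 4 ^ L)%N -> (p %/ w < 4 ^ L)%N.
  by apply: leq_ltn_trans; exact: leq_div.
rewrite !ffunE inord_val.
have -> : ((t0, cell_at L (x %/ 4 ^ (L - (M + t0))) (y %/ 4 ^ (L - (2 * M - t0)))) == (t0, l)) =
   (x %/ 4 ^ (L - (M + t0)) == l ord0)%N && (y %/ 4 ^ (L - (2 * M - t0)) == l ord_max)%N.
  by rewrite xpair_eqE eqxx /= cell_at_eq ?lt_div.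
set ina := (x %/ _ == _)%N; set inb := (y %/ _ == _)%N.
by case: ina; case: inb; rewrite /sign /=; ring.
Qed.

(** The lower corner of the flipped cell represents the whole cell in the coefficients of
    [flip_weight]. *)
Let x0 := (l ord0 * 4 ^ (L - (M + t0)))%N.
Let y0 := (l ord_max * 4 ^ (L - (2 * M - t0)))%N.

(** For [t > t0] a quarter of grid [t] in the second coordinate contains the side of the flipped
    cell, so the factor depends there on the first coordinate only. For [t < t0] the roles are
    exchanged. *)
Definition flip_weight (j : 'I_2) (p : nat) : R :=
  if j == ord0
  then \prod_(t0.+1 <= t < M.+1) riesz_factor L (row_coef L M e y0) (M + t) t p
  else \prod_(0 <= t < t0) riesz_factor L (col_coef L M e x0) (2 * M - t) t p.

Lemma flip_weight_ge0 j p : 0 <= flip_weight j p.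
Proof.
rewrite /flip_weight; case: ifP => _; apply: prodr_ge0 => t _;
  by apply: riesz_factor_ge0 => z; exact: sign_pattern_le1.
Qed.

(** The coarsest factor left in a weight is one level finer than the wave, so the balance holds
    exactly on the quarters of the wave. *)
Lemma flip_weight_balanced j :
  balanced (quarter_width L level t0 j) (4 * 4 ^ level t0 j) (flip_weight j).
Proof.
have tM := ltn_ord t0.
rewrite /flip_weight /quarter_width /riesz_level -expnS; case: ifP => _.
  by rewrite -addnS; apply: balanced_riesz_up; lia.
by rewrite -subSn; [apply: balanced_riesz_down; lia|lia].
Qed.

(** Only factor [t0] changes. Off the flipped cell the change is zero; on it the remaining factors
    split into the two weights. *)
Lemma riesz_product_flip (x y : nat) : (x < 4 ^ L)%N -> (y < 4 ^ L)%N ->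
  riesz_product L M (setbit e (t0, l) true) x y -
  riesz_product L M (setbit e (t0, l) false) x y =
  2 * ((wave convex_pattern (quarter_width L level t0 ord0) (l ord0) x *
        flip_weight ord0 x) *
       (wave convex_pattern (quarter_width L level t0 ord_max) (l ord_max) y *
        flip_weight ord_max y)).
Proof.
move=> xL yL; have tM := ltn_ord t0.
have split b : riesz_product L M (setbit e (t0, l) b) x y =
    riesz_term L M (setbit e (t0, l) b) t0 x y *
    ((\prod_(0 <= t < t0) riesz_term L M e t x y) *
     (\prod_(t0.+1 <= t < M.+1) riesz_term L M e t x y)) :> R.
  rewrite /riesz_product (big_cat_nat (n := t0))//=; last by lia.
  rewrite [X in _ * X]big_ltn// mulrCA; congr (_ * (_ * _)).
    by apply: eq_big_nat => t tt0; apply: riesz_term_setbit; lia.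
  by apply: eq_big_nat => t tt0; apply: riesz_term_setbit; lia.
rewrite !split -mulrBl riesz_term_flip// -[LHS]mulrA; congr (2 * _).
rewrite /wave !(four_quarters L level (riesz_level_lt L M ML)).
set wx := convex_pattern _; set wy := convex_pattern _.
have [xl|_] := eqVneq (x %/ 4 ^ (L - level t0 ord0))%N (l ord0); last by rewrite !mul0r.
have [yl|_] := eqVneq (y %/ 4 ^ (L - level t0 ord_max))%N (l ord_max);
  last by rewrite !mul0r !mulr0 mul0r.
have xx0 : (x %/ 4 ^ (L - (M + t0)) = x0 %/ 4 ^ (L - (M + t0)))%N.
  by rewrite /x0 mulnK ?expn_gt0.
have yy0 : (y %/ 4 ^ (L - (2 * M - t0)) = y0 %/ 4 ^ (L - (2 * M - t0)))%N.
  by rewrite /y0 mulnK ?expn_gt0.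
have -> : \prod_(0 <= t < t0) riesz_term L M e t x y = flip_weight ord_max y.
  rewrite /flip_weight /=; apply: eq_big_nat => t tt0.
  rewrite riesz_term_col /riesz_factor /col_coef.
  have h1 : (L - (M + t0) <= L - (M + t))%N by clear -tt0 tM; lia.
  (* Since [t < t0], even one quarter at level [M + t] is at least as wide as the side of the
     cell. *)
  have h2 : (L - (M + t0) <= L - (M + t).+1)%N by clear -tt0 tM; lia.
  by rewrite (div_expn_coarse _ _ _ _ h1 xx0) (div_expn_coarse _ _ _ _ h2 xx0).
have -> : \prod_(t0.+1 <= t < M.+1) riesz_term L M e t x y = flip_weight ord0 x.
  rewrite /flip_weight /=; apply: eq_big_nat => t tt0.
  rewrite /riesz_term /riesz_factor /row_coef.
  have h1 : (L - (2 * M - t0) <= L - (2 * M - t))%N by clear -tt0 tM; lia.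
  have h2 : (L - (2 * M - t0) <= L - (2 * M - t).+1)%N by clear -tt0 tM; lia.
  by rewrite (div_expn_coarse _ _ _ _ h1 yy0) (div_expn_coarse _ _ _ _ h2 yy0).
ring.
Qed.

End RieszFlip.

(** The product is nonnegative with total [(4 ^ L) ^+ 2], so the amplitude is [V / N ^+ 2] for any
    number of grids. *)
Lemma riesz_lower_bound {R : realType} (L M n : nat) (m : 'I_2 -> nat)
    (x : 'I_n -> {ffun 'I_2 -> R}) (disp : measure_display)
    (T : measurableType disp) (P : probability T R) (xi : 'I_n -> {RV P >-> R})
    (sigma V : R) :
  (2 * M < L)%N -> (forall j, (0 < m j)%N) -> lattice_design m x ->
  (forall j, (4 ^ L <= m j)%N) -> (0 < n)%N -> sigma != 0 ->
  iid_normal sigma xi -> 0 < V ->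
  let E := V ^+ 2 * (4 ^ (2 * L))%:R / 64 ^+ (3 * M) in
  4 * E / 16 ^+ 2 <= sigma ^+ 2 / 2 ->
  ((M.+1%:R * (4 ^ (3 * M))%:R * E / (2 * 64 ^+ 2 * n%:R))%:E
    <= minimax_risk x xi V)%E.
Proof.
move=> ML m_gt0 x_design Lm n_gt0 sigma0 xi_iid V0 E small.
have KdL : (3 * M <= 2 * L)%N by lia.
pose N : R := (4 ^ L)%:R.
have N0 : 0 < N by rewrite ltr0n expn_gt0.
pose a := V / N ^+ 2.
have aE : a ^+ 2 * @cell_size R 2 L (3 * M) ^+ 3 = E.
  have wN : @cell_size R 2 L (3 * M) * (4 ^ (3 * M))%:R = N ^+ 2.
    by rewrite /cell_size -natrM -expnD subnK// -natrX -expnM mulnC.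
  have NE : (4 ^ (2 * L))%:R = N ^+ 2 :> R by rewrite -natrX -expnM mulnC.
  rewrite /a /E NE -wN expr64.
  have w0 : @cell_size R 2 L (3 * M) != 0 by rewrite gt_eqF// ltr0n expn_gt0.
  have k0 : (4 ^ (3 * M))%:R != 0 :> R by rewrite pnatr_eq0 -lt0n expn_gt0.
  move: w0 k0; move: (@cell_size R 2 L (3 * M)) ((4 ^ (3 * M))%:R : R) => w k4 w0 k0.
  by field; rewrite w0 k0.
pose mu (e : {ffun wave_index (d := 2) (Lev := 'I_M.+1) L -> bool})
    (p : {ffun 'I_2 -> 'I_(4 ^ L)}) :=
  a * riesz_product L M e (p ord0) (p ord_max).
have a0 : 0 <= a by rewrite divr_ge0 ?exprn_ge0// ltW.
have := core_lower_bound L (3 * M) (@riesz_level M) (riesz_level_lt L M ML)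
  (sum_riesz_level M) (riesz_level_inj M) KdL n m x m_gt0 x_design Lm n_gt0
  disp T P xi sigma sigma0 xi_iid V a mu.
rewrite card_ord aE; apply.
- move=> e; rewrite (eq_bigr (mu e)); last first.
    move=> p _; rewrite ger0_norm// mulr_ge0//.
    by apply: prodr_ge0 => t _; exact: riesz_term_ge0.
  rewrite sum_ffun2 /mu.
  under eq_bigr do under eq_bigr do rewrite !ffunE /=.
  under eq_bigr do rewrite -mulr_sumr.
  by rewrite -mulr_sumr sum_riesz_product// -/N /a divfK// expf_neq0 ?gt_eqF.
- move=> e [t0 l] _; exists (flip_weight L M e t0 l); split.
  + by move=> j p; exact: flip_weight_ge0.
  + by move=> j; exact: flip_weight_balanced.
  move=> p; rewrite /mu -mulrBr riesz_product_flip//.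
  by rewrite big_ord_recl big_ord1 /= (_ : lift _ _ = ord_max); [ring|exact: val_inj].
- by rewrite -(mulrA 4) aE.
Qed.

(** * Choice of the grids *)

Section SimplexLevels.
Variables (d' M : nat).

(* All levels stay below [2 d' M], less than about two thirds of the depth [L] that the
   lattice allows, while their sum does not depend on [t]. *)
Definition simplex_level (t : {ffun 'I_d' -> 'I_M.+1}) (j : 'I_d'.+1) : nat :=
  oapp (fun i => d' * M + t i)%N (2 * (d' * M) - \sum_i t i)%N (unlift ord_max j).

(** Makes the truncated subtraction in [simplex_level] exact. *)
Lemma sum_simplex_le (t : {ffun 'I_d' -> 'I_M.+1}) : (\sum_i t i <= d' * M)%N.
Proof.
rewrite -[X in (_ <= X * _)%N](card_ord d') -sum_nat_const; apply: leq_sum => i _.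
by rewrite -ltnS.
Qed.

Lemma simplex_level_le t j : (simplex_level t j <= 2 * (d' * M))%N.
Proof.
rewrite /simplex_level; case: unliftP => [i _|_] /=; last exact: leq_subr.
rewrite mul2n -addnn leq_add2l (leq_trans _ (leq_pmull _ _))//.
  by rewrite -ltnS.
(* The existence of an index [i] below [d'] makes [d'] positive. *)
exact: leq_ltn_trans (ltn_ord i).
Qed.

Lemma sum_simplex_level t : (\sum_j simplex_level t j = d' * d'.+2 * M)%N.
Proof.
have liftE (i : 'I_d') : simplex_level t (lift ord_max i) = (d' * M + t i)%N.
  by rewrite /simplex_level liftK.
transitivity (simplex_level t ord_max + \sum_(i < d') (d' * M + t i))%N.
  rewrite (bigD1_ord ord_max)//; congr addn.
  by apply: eq_bigr => i _; exact: liftE.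
rewrite {1}/simplex_level unlift_none /=.
rewrite big_split /= sum_nat_const card_ord.
have := sum_simplex_le t; set s := (\sum_i t i)%N => sM.
have -> : (2 * (d' * M) - s + (d' * (d' * M) + s) = 2 * (d' * M) + d' * (d' * M))%N by lia.
by nia.
Qed.

Lemma simplex_level_inj t t' : t != t' ->
  [exists j, simplex_level t j != simplex_level t' j].
Proof.
move=> tt'; have [i ti] : exists i, t i != t' i.
  apply/existsP; apply: contraNT tt' => /existsPn h; apply/eqP/ffunP => i.
  by apply/eqP; have := h i; rewrite negbK.
apply/existsP; exists (lift ord_max i); rewrite /simplex_level liftK /= eqn_add2l.
exact: ti.
Qed.

End SimplexLevels.

Lemma simplex_lower_bound {R : realType} (d' L M n : nat) (m : 'I_d'.+1 -> nat)
    (x : 'I_n -> {ffun 'I_d'.+1 -> R}) (disp : measure_display)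
    (T : measurableType disp) (P : probability T R) (xi : 'I_n -> {RV P >-> R})
    (sigma V : R) :
  (2 * (d' * M) < L)%N -> (forall j, (0 < m j)%N) -> lattice_design m x ->
  (forall j, (4 ^ L <= m j)%N) -> (0 < n)%N -> sigma != 0 ->
  iid_normal sigma xi -> 0 < V ->
  let E := V ^+ 2 * (4 ^ (d'.+1 * L))%:R / (64 ^+ (d' * d'.+2 * M) * M.+1%:R ^+ d') in
  4 * E / 16 ^+ d'.+1 <= sigma ^+ 2 / 2 ->
  ((M.+1%:R ^+ d' * (4 ^ (d' * d'.+2 * M))%:R * E / (2 * 64 ^+ d'.+1 * n%:R))%:E
    <= minimax_risk x xi V)%E.
Proof.
move=> ML m_gt0 x_design Lm n_gt0 sigma0 xi_iid V0 /= small.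
have card_lev : #|{ffun 'I_d' -> 'I_M.+1}|%:R = M.+1%:R ^+ d' :> R.
  by rewrite card_ffun !card_ord natrX.
have KdL : (d' * d'.+2 * M <= d'.+1 * L)%N by nia.
have lev_gt0 : (0 < #|{ffun 'I_d' -> 'I_M.+1}|)%N.
  by rewrite card_ffun !card_ord expn_gt0.
have kL t j : (simplex_level d' M t j < L)%N.
  exact: leq_ltn_trans (simplex_level_le _ _ _ _) ML.
have := signed_sum_lower_bound L _ _ kL (sum_simplex_level d' M)
  (simplex_level_inj d' M) KdL lev_gt0 n m x m_gt0 x_design Lm n_gt0
  disp T P xi sigma V sigma0 xi_iid V0.
by rewrite card_lev; apply.
Qed.

(** * Numerical choice of the lattice depth and of the number of grids *)

Section ParameterChoice.
Context {R : realType}.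

(** With [b = sigma / sqrt n] and [u] the argument of the logarithm, [sigma ^+ 2 * V / n] is
    [b ^+ 3 * u]. *)
Lemma powR_scaling (sigma V n : R) : 0 < sigma -> 0 < V -> 0 < n ->
  (sigma ^+ 2 * V / n) `^ (2 / 3) =
  sigma ^+ 2 / n * (V * Num.sqrt n / sigma) `^ (2 / 3).
Proof.
move=> s0 V0 n0; pose b := sigma / Num.sqrt n; pose u := V * Num.sqrt n / sigma.
have sn0 : 0 < Num.sqrt n by rewrite sqrtr_gt0.
have nE : n = Num.sqrt n ^+ 2 by rewrite sqr_sqrtr// ltW.
have -> : sigma ^+ 2 / n = b ^+ 2 by rewrite /b {1}nE; field; rewrite gt_eqF.
have -> : sigma ^+ 2 * V / n = b ^+ 3 * u.
  by rewrite {1}nE /b /u; field; rewrite !gt_eqF.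
have b0 : 0 <= b by rewrite divr_ge0// ltW.
have u0 : 0 <= u by rewrite !mulr_ge0 ?invr_ge0// ltW.
rewrite -/u powRM ?exprn_ge0//; congr (_ * _).
by rewrite -powR_mulrn// -powRrM -powR_mulrn//; congr (_ `^ _); field.
Qed.

Lemma exists_pow4_ge (z : R) : exists r : nat, z <= (4 ^ r)%:R.
Proof.
exists (Num.truncn z).+1; apply: (@le_trans _ _ (Num.truncn z).+1%:R).
  by apply: ltW; exact: truncnS_gt.
by rewrite ler_nat ltnW// ltn_expl.
Qed.

(** [4 ^ L] is the largest power of 4 not above [cs * n ^ (1 / d)]; rounding loses at most a factor
    4 per axis. *)
Lemma pow4_scale (cs z : R) (d n L0 : nat) : (0 < d)%N -> 0 < cs ->
  ((4 ^ L0)%:R / cs) ^+ d <= n%:R ->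
  exists L : nat, [/\ (L0 <= L)%N, (4 ^ L)%:R <= cs * n%:R `^ d%:R^-1 &
     (cs / 4) ^+ d * n%:R <= (4 ^ (d * L))%:R].
Proof.
move=> d0 cs0 nL0; pose y : R := cs * n%:R `^ d%:R^-1.
have dR : d%:R != 0 :> R by rewrite pnatr_eq0 -lt0n.
have yd : y ^+ d = cs ^+ d * n%:R.
  rewrite /y exprMn; congr (_ * _).
  by rewrite -powR_mulrn ?powR_ge0// -powRrM mulVf// powRr1.
have y0 : 0 <= y by rewrite mulr_ge0 ?powR_ge0// ltW.
have yL0 : (4 ^ L0)%:R <= y.
  rewrite -(@ler_pXn2r _ d)// ?nnegrE// yd -ler_pdivrMl ?exprn_gt0//.
  by rewrite mulrC -exprVn -exprMn.
have y1 : (0 < Num.truncn y)%N.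
  rewrite truncn_gt0; apply: le_trans yL0.
  by rewrite ler1n expn_gt0.
exists (trunc_log 4 (Num.truncn y)); have /andP[lo hi] := trunc_log_bounds (isT : (1 < 4)%N) y1.
have lo' : (4 ^ trunc_log 4 (Num.truncn y))%:R <= y.
  by rewrite -truncn_ge_nat//.
have hi' : y < (4 ^ (trunc_log 4 (Num.truncn y)).+1)%:R.
  by apply: lt_le_trans (truncnS_gt y) _; rewrite ler_nat.
split => //.
  have := le_lt_trans yL0 hi'; rewrite ltr_nat ltn_exp2l// ltnS.
rewrite expr_div_n mulrAC -yd ler_pdivrMr ?exprn_gt0//.
rewrite mulnC expnM natrX -exprMn.
have := ltW hi'; rewrite expnS natrM mulrC => h.
by rewrite ler_pXn2r// ?nnegrE// mulr_ge0.
Qed.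
End ParameterChoice.

Section LevelChoice.
Context {R : realType}.

(** [M] is the least solution of the first inequality. The step from [M - 1] to [M] multiplies the
    expression by at most [64 ^+ D * 2 ^+ e], and [1 < X] excludes [M = 0]. *)
Lemma level_choice (D e : nat) (X : R) : (0 < D)%N -> 1 < X ->
  exists M : nat, [/\ X <= 64 ^+ (D * M) * M.+1%:R ^+ e,
    64 ^+ (D * M) * M.+1%:R ^+ e <= 64 ^+ D * 2 ^+ e * X,
    64 ^+ (D * M.-1) < X & (0 < M)%N].
Proof.
move=> D0 X1; pose G (M : nat) : R := 64 ^+ (D * M) * M.+1%:R ^+ e.
have G_ge (M : nat) : 64 ^+ (D * M) <= G M.
  by rewrite ler_peMr ?exprn_ge0// exprn_ege1// ler1n.
have ex : exists M, X <= G M.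
  exists (Num.truncn X).+1; apply: le_trans (G_ge _).
  apply: le_trans (ltW (truncnS_gt X)) _.
  apply: (@le_trans _ _ (64 ^ (Num.truncn X).+1)%:R).
    by rewrite ler_nat ltnW// ltn_expl.
  by rewrite natrX ler_weXn2l ?leq_pmull// ler1n.
have [M XM Mmin] := ex_minnP ex; exists M.
case: M XM Mmin => [|k] XM Mmin.
  by move: XM; rewrite /G muln0 expr0 mul1r expr1n leNgt X1.
have Xk : G k < X.
  by rewrite ltNge; apply/negP => /Mmin; rewrite ltnn.
split => //; last exact: le_lt_trans (G_ge k) Xk.
apply: (@le_trans _ _ (64 ^+ D * 2 ^+ e * G k)); last first.
  by rewrite ler_wpM2l ?ltW// mulr_gt0// exprn_gt0.
rewrite /G mulnS exprD -!mulrA ler_wpM2l ?exprn_ge0// mulrCA.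
rewrite ler_wpM2l ?exprn_ge0// -exprMn lerXn2r ?nnegrE ?mulr_ge0//.
by rewrite -natrM ler_nat; lia.
Qed.

(** Since [M + 1 <= 64 ^ (M + 1)], the polynomial factor is absorbed into the exponential; [M + 1]
    is thus at least of the order of the logarithm. *)
Lemma ln_le_level (D e M : nat) (X : R) : 0 < X ->
  X <= 64 ^+ (D * M) * M.+1%:R ^+ e -> ln X <= (D + e)%:R * ln 64 * M.+1%:R.
Proof.
move=> X0 XM.
have X64 : X <= 64 ^+ ((D + e) * M.+1).
  apply: le_trans XM _; rewrite mulnDl exprD ler_pM ?exprn_ge0//.
    by rewrite ler_weXn2l ?ler1n// leq_mul2l leqnSn orbT.
  rewrite mulnC exprM lerXn2r ?nnegrE ?exprn_ge0//.
  by rewrite -natrX ler_nat ltnW// ltn_expl.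
have h : ln X <= ln (64 ^+ ((D + e) * M.+1)).
  by rewrite ler_ln// posrE// exprn_gt0.
apply: le_trans h _; rewrite lnXn// -[leLHS]mulr_natr natrM.
by rewrite le_eqVlt; apply/orP; left; apply/eqP; ring.
Qed.

(* The exponent [e] is [d'] for signed sums and 0 for Riesz products. *)
Lemma parameter_choice (d' e : nat) (cs : R) : (0 < d')%N -> (e <= d')%N ->
  0 < cs <= 1 ->
  exists2 C : R, 0 < C & forall rho : R, 0 < rho ->
  exists2 N : R, 0 < N & forall V sigma : R, 0 < V -> 0 < sigma ->
    sigma ^+ 2 / V ^+ 2 = rho -> forall n : nat, N < n%:R ->
  exists L M : nat,
    let E := V ^+ 2 * (4 ^ (d'.+1 * L))%:R /
             (64 ^+ (d' * d'.+2 * M) * M.+1%:R ^+ e) in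
    [/\ (4 ^ L)%:R <= cs * n%:R `^ d'.+1%:R^-1,
        (2 * (d' * M) < L)%N, 4 * E / 16 ^+ d'.+1 <= sigma ^+ 2 / 2 &
        C * (sigma ^+ 2 * V / n%:R) `^ (2 / 3) *
          ln (V * Num.sqrt n%:R / sigma) `^ (d'%:R - e%:R / 3) <=
        M.+1%:R ^+ d' * (4 ^ (d' * d'.+2 * M))%:R * E / (2 * 64 ^+ d'.+1 * n%:R)].
Proof.
move=> d'0 ed' /andP[cs0 cs1]; set D := (d' * d'.+2)%N; set al := d'%:R - e%:R / 3.
have D0 : (0 < D)%N by rewrite muln_gt0 d'0.
have al0 : 0 <= al.
  have : e%:R <= d'%:R :> R by rewrite ler_nat.
  have : 0 <= e%:R :> R by [].
  by rewrite /al; lra.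
pose c3 : R := (cs / 4) ^+ d'.+1.
have c30 : 0 < c3 by rewrite exprn_gt0// divr_gt0.
pose B : R := (D + e)%:R * ln 64.
have B0 : 0 < B.
  apply: mulr_gt0; first by rewrite ltr0n addn_gt0 D0.
  by rewrite ln_gt0// ltr1n.
pose A : R := 64 ^+ D * 2 ^+ e.
have A0 : 0 < A by rewrite mulr_gt0// exprn_gt0.
exists (c3 `^ 3^-1 * B^-1 `^ al / (A * (2 * 64 ^+ d'.+1))).
  apply: divr_gt0; first by rewrite mulr_gt0 ?powR_gt0 ?invr_gt0.
  by rewrite !mulr_gt0 ?exprn_gt0.
move=> rho rho0.
have [r hr] := exists_pow4_ge (Num.max rho rho^-1).
have r1 : rho <= (4 ^ r)%:R by apply: le_trans hr; rewrite le_max lexx.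
have r2 : rho^-1 <= (4 ^ r)%:R by apply: le_trans hr; rewrite le_max lexx orbT.
(* [2 * r] absorbs [rho], both in [1 < X] and in [2 * (d' * M) < L]; the other terms absorb the
   rounding of [M]. *)
pose L0 := (2 * r + 6 * (d' * d'.+2) + 1)%N.
have N1 : 0 <= ((4 ^ L0)%:R / cs) ^+ d'.+1 by rewrite exprn_ge0// divr_ge0// ltW.
have N2 : 0 < rho / c3 ^+ 2 by rewrite divr_gt0// exprn_gt0.
(* The first summand ensures [L0 <= L], the second [1 <= c3 * u]. *)
exists (((4 ^ L0)%:R / cs) ^+ d'.+1 + rho / c3 ^+ 2); first exact: ltr_wpDl.
move=> V sigma V0 s0 rhoE n nN.
have n0 : 0 < n%:R :> R by apply: lt_trans nN; exact: ltr_wpDl.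
have [|L [L0L Lz Ln]] := @pow4_scale R cs 0 d'.+1 n L0 isT cs0.
  by apply: ltW (le_lt_trans _ nN); rewrite lerDl ltW.
(* [X] is the denominator at which [E] would equal [sigma ^+ 2], the order up to which a flipped bit
   stays undetectable; [M] is chosen to reach it up to a constant. *)
pose X : R := (4 ^ (d'.+1 * L))%:R / rho.
have XE : X = V ^+ 2 * (4 ^ (d'.+1 * L))%:R / sigma ^+ 2.
  by rewrite /X -rhoE; field; rewrite !gt_eqF.
have X1 : 1 < X.
  rewrite ltr_pdivlMr// mul1r; apply: le_lt_trans r1 _.
  rewrite ltr_nat ltn_exp2l// (leq_trans _ (leq_pmull _ _))// (leq_trans _ L0L)//.
  by rewrite /L0; clear; lia.
have X0 : 0 < X by apply: lt_trans X1.
have [M [XM MX Mlt M0]] := level_choice D e X D0 X1.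
exists L, M; move=> E.
set G := 64 ^+ (D * M) * M.+1%:R ^+ e in XM MX E *.
have G0 : 0 < G by rewrite mulr_gt0 ?exprn_gt0// ltr0n.
have EE : E = sigma ^+ 2 * (X / G).
  by rewrite /E XE; field; rewrite !gt_eqF.
have s2 : 0 < sigma ^+ 2 by rewrite exprn_gt0.
split => //.
(* Comparing exponents of 4 gives [3 * D * (M - 1) < (d' + 1) * L + r]. As [D = d' * (d' + 2)], this
   puts [2 * d' * M] below about two thirds of [L], and [L0 <= L] pays for the bounded terms. *)
- have : (4 ^ (3 * (D * M.-1)))%:R < (4 ^ (d'.+1 * L + r))%:R :> R.
    rewrite (_ : (4 ^ (3 * (D * M.-1)))%:R = 64 ^+ (D * M.-1)); last first.
      by rewrite natrX exprM (_ : 4 ^+ 3 = 64 :> R) // -natrX.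
    apply: lt_le_trans Mlt _; rewrite /X expnD natrM ler_wpM2l//.
  rewrite ltr_nat ltn_exp2l//; move: M0 L0L; rewrite /D /L0; clear.
  case: M => // M _ /= L0L h.
  have h' : (2 * (d' * M) * (3 * d'.+2) < 2 * (d'.+1 * L + r))%N by nia.
  nia.
- have XG : X / G <= 1 by rewrite ler_pdivrMr// mul1r.
  have E1 : E <= sigma ^+ 2 by rewrite EE ger_pMr.
  have e16 : 16 <= 16 ^+ d'.+1 :> R by rewrite exprS ler_peMr// exprn_ege1// ler1n.
  rewrite ler_pdivrMr ?exprn_gt0//.
  have : sigma ^+ 2 * 16 <= sigma ^+ 2 * 16 ^+ d'.+1 by rewrite ler_wpM2l// ltW.
  lra.
rewrite powR_scaling//; set u := V * Num.sqrt n%:R / sigma.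
have u0 : 0 < u by rewrite divr_gt0 ?mulr_gt0 ?sqrtr_gt0.
have u2 : u ^+ 2 = n%:R / rho.
  rewrite /u !exprMn sqr_sqrtr ?ltW// -rhoE exprVn.
  by field; rewrite !gt_eqF.
have c3u : 1 <= c3 * u.
  have c3u0 : 0 <= c3 * u by rewrite mulr_ge0// ltW.
  rewrite -(@ler_pXn2r _ 2)// ?nnegrE// expr1n exprMn u2.
  rewrite mulrA ler_pdivlMr// mul1r -ler_pdivrMl ?(exprn_gt0 2 c30)// mulrC.
  by apply: ltW (le_lt_trans _ nN); rewrite lerDr.
have Xu2 : c3 * u ^+ 2 <= X.
  by rewrite u2 /X mulrA ler_pM2r ?invr_gt0.
have Xu : u <= X.
  apply: le_trans Xu2; by rewrite expr2 mulrA ler_peMl// ltW.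
have c31 : c3 <= 1.
  rewrite exprn_ile1// ?divr_ge0 ?ltW// ltr_pdivrMr// mul1r (le_lt_trans cs1)//.
  by rewrite ltr1n.
have u1 : 1 <= u by apply: le_trans c3u _; rewrite ger_pMl.
have lnu0 : 0 <= ln u by rewrite ln_ge0.
have lnuM : ln u <= B * M.+1%:R.
  apply: le_trans (ln_le_level D e M X X0 XM).
  by rewrite ler_ln ?posrE.
(* [f1] trades the logarithm for [M + 1], and [f2] is the cube root of [c3 * u ^+ 2 <= G]; the
   exponents of [M + 1] add up as [al + e / 3 = d']. *)
have key : c3 `^ 3^-1 * u `^ (2 / 3) * (B^-1 `^ al * ln u `^ al) <=
    M.+1%:R ^+ d' * (4 ^ (D * M))%:R.
  have f1 : B^-1 `^ al * ln u `^ al <= M.+1%:R `^ al.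
    have Bi0 : 0 <= B^-1 by rewrite invr_ge0 ltW.
    rewrite -powRM//; apply: ge0_ler_powR => //; rewrite ?nnegrE ?mulr_ge0//.
    by rewrite mulrC ler_pdivrMr// mulrC.
  have f2 : c3 `^ 3^-1 * u `^ (2 / 3) <= (4 ^ (D * M))%:R * (M.+1%:R `^ (e%:R / 3)).
    have -> : (4 ^ (D * M))%:R * M.+1%:R `^ (e%:R / 3) = G `^ 3^-1 :> R.
      rewrite /G powRM ?exprn_ge0// expr64 -powR_mulrn// -powRrM mulfV// powRr1//.
      by rewrite -[X in _ = _ * X `^ _]powR_mulrn// -powRrM.
    have -> : c3 `^ 3^-1 * u `^ (2 / 3) = (c3 * u ^+ 2) `^ 3^-1.
      rewrite powRM ?(ltW c30) ?sqr_ge0//; congr (_ * _).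
      by rewrite -(powR_mulrn 2 (ltW u0)) -powRrM.
    have c3u2 : 0 <= c3 * u ^+ 2 by rewrite mulr_ge0 ?(ltW c30) ?sqr_ge0.
    apply: ge0_ler_powR; rewrite ?nnegrE ?(ltW G0) ?invr_ge0//.
    exact: le_trans Xu2 XM.
  apply: le_trans (ler_pM _ _ f2 f1) _; rewrite ?mulr_ge0 ?powR_ge0//.
  rewrite -mulrA -powRD; last by rewrite pnatr_eq0 implybT.
  rewrite /al addrC subrK powR_mulrn// mulrC.
  by [].
have low : sigma ^+ 2 / A <= E.
  rewrite EE; apply: ler_wpM2l; first exact: ltW.
  by rewrite ler_pdivlMr// ler_pdivrMl.
apply: (@le_trans _ _ (M.+1%:R ^+ d' * (4 ^ (D * M))%:R * (sigma ^+ 2 / A) /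
    (2 * 64 ^+ d'.+1 * n%:R))); last first.
  rewrite ler_wpM2r ?invr_ge0 ?mulr_ge0 ?exprn_ge0//.
  by rewrite ler_wpM2l// mulr_ge0// exprn_ge0.
have -> : M.+1%:R ^+ d' * (4 ^ (D * M))%:R * (sigma ^+ 2 / A) / (2 * 64 ^+ d'.+1 * n%:R) =
  M.+1%:R ^+ d' * (4 ^ (D * M))%:R * (sigma ^+ 2 / n%:R / (A * (2 * 64 ^+ d'.+1))).
  by field; rewrite !gt_eqF ?exprn_gt0.
have -> : c3 `^ 3^-1 * B^-1 `^ al / (A * (2 * 64 ^+ d'.+1)) *
   (sigma ^+ 2 / n%:R * u `^ (2 / 3)) * ln u `^ al =
   c3 `^ 3^-1 * u `^ (2 / 3) * (B^-1 `^ al * ln u `^ al) *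
   (sigma ^+ 2 / n%:R / (A * (2 * 64 ^+ d'.+1))).
  by field; rewrite !gt_eqF ?exprn_gt0.
apply: ler_wpM2r key; rewrite !divr_ge0 ?mulr_ge0 ?exprn_ge0// ltW//.
Qed.

End LevelChoice.

(** For negative [x] the right side is still nonnegative, so the plain logarithm can replace its
    first power without a sign condition. *)
Lemma le_powR1 {R : realType} (x : R) : x <= x `^ 1.
Proof.
by case: (leP 0 x) => [x0|x0]; [rewrite powRr1|apply: le_trans (ltW x0) (powR_ge0 _ _)].
Qed.

Theorem theorem4p6 (R : realType) (cs : R) (cs01 : 0 < cs <= 1) :
  (forall d : nat, (2 <= d)%N ->
     exists2 C : R, 0 < C &
     forall rho : R, 0 < rho ->
     exists2 N : R, 0 < N &
     forall (V sigma : R), 0 < V -> 0 < sigma -> sigma ^+ 2 / V ^+ 2 = rho ->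
     forall (m : 'I_d -> nat) (n : nat),
       (forall j, (1 <= m j)%N) ->
       n = (\prod_(j < d) m j)%N ->
       (forall j, cs * n%:R `^ d%:R^-1 <= (m j)%:R) ->
     forall x : 'I_n -> {ffun 'I_d -> R}, lattice_design m x ->
     forall (disp : measure_display) (T : measurableType disp)
       (P : probability T R) (xi : 'I_n -> {RV P >-> R}),
       iid_normal sigma xi ->
     N < n%:R ->
     ((C * (sigma ^+ 2 * V / n%:R) `^ (2 / 3)
         * ln (V * Num.sqrt n%:R / sigma) `^ (2 * (d%:R - 1) / 3))%:E
        <= minimax_risk x xi V)%E)
  /\
  (exists2 C : R, 0 < C &
     forall rho : R, 0 < rho ->
     exists2 N : R, 0 < N &
     forall (V sigma : R), 0 < V -> 0 < sigma -> sigma ^+ 2 / V ^+ 2 = rho ->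
     forall (m : 'I_2 -> nat) (n : nat),
       (forall j, (1 <= m j)%N) ->
       n = (\prod_(j < 2) m j)%N ->
       (forall j, cs * n%:R `^ 2^-1 <= (m j)%:R) ->
     forall x : 'I_n -> {ffun 'I_2 -> R}, lattice_design m x ->
     forall (disp : measure_display) (T : measurableType disp)
       (P : probability T R) (xi : 'I_n -> {RV P >-> R}),
       iid_normal sigma xi ->
     N < n%:R ->
     ((C * (sigma ^+ 2 * V / n%:R) `^ (2 / 3)
         * ln (V * Num.sqrt n%:R / sigma))%:E
        <= minimax_risk x xi V)%E).
Proof.
split.
  case=> // d' d2.
  have [C C0 choice] := parameter_choice d' d' cs d2 (leqnn d') cs01.
  exists C => // rho rho0; have [N N0 {}choice] := choice rho rho0.
  exists N => // V sigma V0 s0 rhoE m n m1 nE mz x x_design disp T P xi xi_iid Nn.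
  have [L [M [Lz ML small bound]]] := choice V sigma V0 s0 rhoE n Nn.
  have Lm j : (4 ^ L <= m j)%N by rewrite -(ler_nat R); apply: le_trans Lz (mz j).
  have n0 : (0 < n)%N by rewrite -(ltr_nat R); apply: lt_trans Nn.
  have := simplex_lower_bound d' L M n m x disp T P xi sigma V ML m1 x_design Lm n0
    (lt0r_neq0 s0) xi_iid V0 small.
  apply: le_trans; rewrite lee_fin; apply: le_trans bound.
  (* With [d = d' + 1] the exponent of the logarithm is [2 * d' / 3]. *)
  rewrite (_ : 2 * _ / 3 = d'%:R - d'%:R / 3)//.
  by rewrite -natr1; field.
(* For Riesz products the number of grids does not enter [E], so [e = 0] and the exponent of the
   logarithm is [d' = 1]. *)
have [C C0 choice] := parameter_choice 1 0 cs isT isT cs01.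
exists C => // rho rho0; have [N N0 {}choice] := choice rho rho0.
exists N => // V sigma V0 s0 rhoE m n m1 nE mz x x_design disp T P xi xi_iid Nn.
have [L [M [Lz]]] := choice V sigma V0 s0 rhoE n Nn.
rewrite expr0 mulr1 expr1 mul0r subr0 mul1n => ML small bound.
have Lm j : (4 ^ L <= m j)%N by rewrite -(ler_nat R); apply: le_trans Lz (mz j).
have n0 : (0 < n)%N by rewrite -(ltr_nat R); apply: lt_trans Nn.
have := riesz_lower_bound L M n m x disp T P xi sigma V ML m1 x_design Lm n0
  (lt0r_neq0 s0) xi_iid V0 small.
apply: le_trans; rewrite lee_fin; apply: le_trans bound.
by rewrite ler_wpM2l ?le_powR1// mulr_ge0 ?powR_ge0// ltW.
Qed.
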